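(* In the setting of the context, let $\mathcal W'$ be a countable collection of walks which may contain each walk multiple but only finitely many times, let $g\in L_+(H)^E$, let $\mathcal M\subseteq\mathrm{dom}(\mathcal W')\cap L_+(H)^{\mathcal W'}$ contain at least one $h$ with $\sum_{w\in\mathcal W'}\ell^u_w(h_w)\le g$, and let $\vartheta:\ell^1(\mathcal W',L_+(H))\to\mathbb R$. Assume $\vartheta$ is sequentially weakly continuous and $\mathcal M$ is sequentially weakly closed in $\mathrm{dom}(\mathcal W')$. Then the optimization problem $\max_h \vartheta(h)$ subject to $\sum_{w\in\mathcal W'}\ell^u_w(h_w)\le g$, $h\in\mathcal M$, has an optimal solution.
   Context: $G=(V,E)$ finite directed graph; $H=[0,t_f]$ with Lebesgue measure $\sigma$; $L(H)$ integrable real functions up to a.e. equality, $L_+(H)$ nonnegative ones; inequalities are a.e. A walk is $w=(e_1,\dots,e_k)$, $e_j=(v_j,v_{j+1})\in E$, $w[j]=e_j$, $|w|=k$. Fix $u\in L(H)^E$ with induced nonnegative absolutely continuous traversal times $D_e(u,\cdot)$ such that $T_e(u,t):=t+D_e(u,t)$ is nondecreasing; $A_{w,1}(u,\cdot)=\mathrm{id}$, $A_{w,j}(u,\cdot)=T_{w[j-1]}(u,\cdot)\circ\dots\circ T_{w[1]}(u,\cdot)$ ($2\le j\le|w|+1$). Standing assumption: $u$ vanishes a.e. on $[t_f',t_f]$ for some $t_f'<t_f$ and all $A_{w,j}(u,\cdot)$ map $H$ into $H$. $\ell^u_{w,e}(h)$ denotes (if it exists) the function in $L(H)$ with $\int_0^t\ell^u_{w,e}(h)\,d\sigma=\sum_{j\le|w|:w[j]=e}\int_{A_{w,j}(u,\cdot)^{-1}([0,t])}h\,d\sigma$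 for all $t\in H$; $\ell^u_w(h)=(\ell^u_{w,e}(h))_{e\in E}$. $\ell^1(\mathcal W',L(H))=\{h\in L(H)^{\mathcal W'}:\sum_w\|h_w\|<\infty\}$ (with norm and weak topology), $\ell^1(\mathcal W',L_+(H))$ its nonnegative part, $\ell^1(\mathcal W',L(H)^E)=\{f\in(L(H)^E)^{\mathcal W'}:\sum_w\sum_e\|f^w_e\|<\infty\}$. $\mathrm{dom}(\mathcal W')$ is the set of $h\in L(H)^{\mathcal W'}$ such that all $\ell^u_w(h_w)$ exist and $(\ell^u_w(h_w))_{w}\in\ell^1(\mathcal W',L(H)^E)$. *)

(* Defs.v *)
From HB Require Import structures.
From mathcomp Require Import all_boot all_order all_algebra finmap.
From mathcomp Require Import all_classical all_reals all_analysis.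

Set Implicit Arguments.
Unset Strict Implicit.
Unset Printing Implicit Defensive.

Import Order.TTheory GRing.Theory Num.Theory.
Import numFieldNormedType.Exports.

Local Open Scope classical_set_scope.
Local Open Scope ring_scope.

Section Graph.
Context (V : finType) (E : {set V * V}).

Definition edge := {e : V * V | e \in E}.

(* Walks have at least one edge; the end of each edge is the start of the
   next one. *)
Definition is_walk (s : seq edge) : bool :=
  (s != [::]) && sorted (fun e f : edge => (val e).2 == (val f).1) s.

Definition walk := {s : seq edge | is_walk s}.

End Graph.

Section Horizon.
Context {R : realType} (tf : R).

Definition horizon : set R := `[0, tf].

Lemma measurable_horizon : measurable (horizon : set (measurableTypeR R)).
Proof. exact: measurable_itv. Qed.

(* Lebesgue measure on the horizon, as a measure on R that ignores everything
   outside the horizon; "almost everywhere" below always refers to it. *)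
Definition sigma : {measure set (measurableTypeR R) -> \bar R} :=
  mrestr (@lebesgue_measure R) measurable_horizon.

Definition nonneg_on_horizon (f : R -> R) : Prop :=
  forall t, horizon t -> 0 <= f t.

Definition abs_continuous_on_horizon (f : R -> R) : Prop :=
  forall eps : R, 0 < eps -> exists2 delta : R, 0 < delta &
  forall (n : nat) (a b : 'I_n -> R),
    (forall k, horizon (a k) /\ horizon (b k) /\ a k <= b k) ->
    trivIset setT (fun k => [set` `]a k, b k[%R]) ->
    \sum_(k < n) (b k - a k) < delta ->
    \sum_(k < n) `|f (b k) - f (a k)| < eps.

End Horizon.

(* L(H): the library's quotient of the measurable functions by a.e. equality,
   restricted to finite L^1 norm; elements coerce to representatives. *)
Notation LH tf := (LspaceType1 (sigma tf)).

Section FunctionSpaces.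
Context {R : realType} (tf : R).
Local Notation L := (LH tf).

Definition Lnorm1 (f : L) : \bar R := 'N[sigma tf]_1[EFin \o f].

Definition Lle (f g : L) : Prop := {ae sigma tf, forall x, f x <= g x}.

Definition Lnonneg (f : L) : Prop := {ae sigma tf, forall x, 0 <= f x}.

(* s is the sum of the family f in the Banach space L(H): the net of finite
   partial sums converges to s in norm. *)
Definition Lsum (I : countType) (f : I -> L) (s : L) : Prop :=
  forall eps : R, 0 < eps -> exists J0 : {fset I},
  forall J : {fset I}, (J0 `<=` J)%fset ->
    ('N[sigma tf]_1[(fun x => (\sum_(i <- J) f i x - s x)%:E)] < eps%:E)%E.

Section L1Families.
Context {I : countType}.
Implicit Types (h f g : I -> L).

Definition l1norm h : \bar R := \esum_(i in [set: I]) Lnorm1 (h i).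

Definition l1 : set (I -> L) := [set h | (l1norm h < +oo)%E].

Definition nonneg_family : set (I -> L) := [set h | forall i, Lnonneg (h i)].

Definition l1_nonneg : set (I -> L) := l1 `&` nonneg_family.

(* Continuous linear functionals on l^1(I, L(H)). As the library's L^1 carries
   no vector space structure, k = a f + g is expressed on representatives.
   The values of phi outside l1 are irrelevant. *)
Definition l1_linear (phi : (I -> L) -> R) : Prop :=
  forall (a : R) f g k, l1 f -> l1 g -> l1 k ->
    (forall i, {ae sigma tf, forall x, k i x = a * f i x + g i x}) ->
    phi k = a * phi f + phi g.

Definition l1_bounded (phi : (I -> L) -> R) : Prop :=
  exists C : R, forall f, l1 f -> `|phi f| <= C * fine (l1norm f).

Definition weak_cvg (h_ : nat -> I -> L) h : Prop :=
  (forall n, l1 (h_ n)) /\ l1 h /\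
  forall phi, l1_linear phi -> l1_bounded phi ->
    phi (h_ n) @[n --> \oo] --> phi h.

Definition seq_weakly_continuous (D : set (I -> L)) (theta : (I -> L) -> R) :
    Prop :=
  forall (h_ : nat -> I -> L) h, (forall n, D (h_ n)) -> D h -> weak_cvg h_ h ->
    theta (h_ n) @[n --> \oo] --> theta h.

Definition seq_weakly_closed_in (D M : set (I -> L)) : Prop :=
  forall (h_ : nat -> I -> L) h, (forall n, M (h_ n)) -> D h -> weak_cvg h_ h -> M h.

End L1Families.

End FunctionSpaces.

Section Loading.
Context {R : realType} (tf : R) {V : finType} {E : {set V * V}}.
Local Notation L := (LH tf).

(* D u e t is the traversal time of edge e under u when entering at time t. *)
Variables (D : (edge E -> L) -> edge E -> R -> R) (u : edge E -> L).

Definition exit_time (e : edge E) (t : R) : R := t + D u e t.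

(* Positions are 0-based: arrival w j is A_{w,j+1}, for 0 <= j <= |w|. *)
Definition arrival (w : seq (edge E)) (j : nat) (t : R) : R :=
  foldl (fun s e => exit_time e s) t (take j w).

Definition u_vanishes_eventually : Prop :=
  exists2 tf' : R, tf' < tf &
  forall e, {ae sigma tf, forall x, tf' <= x <= tf -> u e x = 0}.

Definition arrivals_in_horizon : Prop :=
  forall (w : walk E) (j : nat), (j <= size (val w))%N ->
  forall t, horizon tf t -> horizon tf (arrival (val w) j t).

(* f satisfies the defining equation of ell^u_{w,e}(h). *)
Definition is_load (w : walk E) (e : edge E) (h f : L) : Prop :=
  forall t, horizon tf t ->
    \int[sigma tf]_(x in `[0, t]) f x =
    \sum_(j < size (val w) | tnth (in_tuple (val w)) j == e)
      \int[sigma tf]_(x in horizon tf `&` arrival (val w) j @^-1` `[0, t]) h x.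

(* ell^u_{w,e}(h), with the junk value h if it does not exist. *)
Definition load (w : walk E) (e : edge E) (h : L) : L :=
  if pselect (exists f, is_load w e h f) is left ex then projT1 (cid ex) else h.

Context {I : countType} (W : I -> walk E).

Definition dom : set (I -> L) := [set h |
  (forall i e, exists f, is_load (W i) e (h i) f) /\
  (\esum_(i in [set: I]) \sum_(e : edge E) Lnorm1 (load (W i) e (h i))
     < +oo)%E].

Definition total_load_le (h : I -> L) (g : edge E -> L) : Prop :=
  exists s : edge E -> L,
    (forall e, Lsum (fun i => load (W i) e (h i)) (s e)) /\
    (forall e, Lle (s e) (g e)).

End Loading.

(* Main.v *)
Require Import Defs.
From HB Require Import structures.
From mathcomp Require Import all_boot all_order all_algebra finmap.
From mathcomp Require Import all_classical all_reals all_analysis measurable_realfun.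
From mathcomp Require Import ring lra.

Set Implicit Arguments.
Unset Strict Implicit.
Unset Printing Implicit Defensive.

Import Order.TTheory GRing.Theory Num.Theory.
Import numFieldNormedType.Exports.

Local Open Scope classical_set_scope.
Local Open Scope ring_scope.

(* Let h_n be a maximizing sequence.  The edge loads of the i-th walk are at most
   g and the load of its first edge is at least h_n(i), so the flows and their
   loads lie in order intervals of L(H).  A subsequence converges weakly in every
   coordinate: along an ultrafilter on nat the integrals over each set converge to
   an absolutely continuous set function, whose density is the limit, and a
   diagonal choice makes this happen along a sequence for a countable pi-system of
   sets.  The limits of the loads are the loads of the limit, so the limit h is
   feasible.  Finally the total volume of the loads of a walk w is |w| times the
   volume of its flow; hence the long walks carry little flow, uniformly in n, and
   since only finitely many walks are short, coordinatewise convergence implies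
   weak convergence in l^1. *)

(** * Set functions and integrals over sets *)

(** Elements of L(H) are known only up to null sets, and bounded sets of L^1 need not be weakly
    compact. Both obstacles are met by replacing a function f by the set function sending A to the
    integral of f over A: equations and inequalities then hold for every measurable A, pass to
    limits as statements about numbers, and turn back into almost everywhere statements at the end.
    Compactness comes from the fixed bound g, which makes these set functions small on small sets
    uniformly in n; this is what keeps an ultrafilter limit countably additive. The ultrafilter
    alone would not do, since [theta] and [M] are controlled only along sequences. Finally, [theta]
    is not known beforehand to be bounded on the feasible set; the maximizing sequence is therefore
    chosen by truncated values, and boundedness follows once a limit exists. *)

Definition cont_at_set0 d (T : measurableType d) (R : realType)
    (m : set T -> R) :=
  forall F : (set T)^nat, (forall n, measurable (F n)) ->
    nonincreasing_seq F -> \bigcap_n F n = set0 -> m (F n) @[n --> \oo] --> 0.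

(** Finite additivity only: this much survives a limit along an ultrafilter. Countable additivity is
    recovered later from a majorant satisfying [cont_at_set0]. *)
Definition set_additive d (T : measurableType d) (R : realType)
    (nu : set T -> R) :=
  forall A B, measurable A -> measurable B -> A `&` B = set0 ->
    nu (A `|` B) = nu A + nu B.

Section Setwise.
Context d (T : measurableType d) (R : realType).
Variable mu : {finite_measure set T -> \bar R}.
Implicit Types (f g : T -> R) (A B : set T).

Local Notation L1 f := (mu.-integrable setT (EFin \o f)).

Lemma L1_int f A : L1 f -> measurable A -> mu.-integrable A (EFin \o f).
Proof. by move=> fi mA; exact: integrableS fi. Qed.

Lemma L1_measurable f : L1 f -> measurable_fun setT f.
Proof. by move=> /measurable_int/measurable_EFinP. Qed.

Lemma EFin_Rint f A : L1 f -> measurable A ->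
  (\int[mu]_(x in A) f x)%:E = (\int[mu]_(x in A) (f x)%:E)%E.
Proof.
by move=> fi mA; rewrite fineK//; apply: integrable_fin_num => //; exact: L1_int.
Qed.

(** One shape of combination serves for sums, multiples and differences; this is why differences
    appear below as [-1 * f x + g x]. *)
Lemma L1_lin a f g : L1 f -> L1 g -> L1 (fun x => a * f x + g x).
Proof.
move=> fi gi; rewrite (_ : _ \o _ = (fun x => a%:E * (EFin \o f) x) \+ (EFin \o g))%E.
  by apply: integrableD => //; exact: integrableZl.
by apply/funext => x /=; rewrite EFinD EFinM.
Qed.

Lemma L1_cst (a : R) : L1 (fun _ => a).
Proof. exact: finite_measure_integrable_cst. Qed.

Lemma L1_indic A : measurable A -> L1 \1_A.
Proof. exact: integrable_indic. Qed.

Lemma L1_le f g : measurable_fun setT f -> L1 g -> (forall x, `|f x| <= g x) ->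
  L1 f.
Proof.
move=> mf gi fg; apply: le_integrable gi => //; first exact/measurable_EFinP.
by move=> x _ /=; rewrite lee_fin (le_trans (fg x))// ler_norm.
Qed.

Lemma L1_norm f : L1 f -> L1 (fun x => `|f x|).
Proof. by move=> fi; exact: integrable_norm. Qed.

Lemma L1_bounded (C : R) f : measurable_fun setT f -> (forall x, `|f x| <= C) -> L1 f.
Proof. by move=> mf fC; apply: (L1_le mf (L1_cst C)). Qed.

Lemma L1_bM (C : R) (b : T -> R) f : measurable_fun setT b -> (forall x, `|b x| <= C) ->
  L1 f -> L1 (fun x => b x * f x).
Proof.
move=> mb bC fi.
have /L1_norm fi' := fi.
apply: (L1_le _ (L1_lin C fi' (L1_cst 0))) => [|x /=].
  by apply: measurable_funM => //; exact: L1_measurable.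
by rewrite addr0 normrM ler_wpM2r.
Qed.

Lemma Rint_lin a f g A : L1 f -> L1 g -> measurable A ->
  \int[mu]_(x in A) (a * f x + g x) =
  a * \int[mu]_(x in A) f x + \int[mu]_(x in A) g x.
Proof.
move=> fi gi mA; rewrite RintegralD ?RintegralZl//; try exact: L1_int.
have := L1_lin a fi (L1_cst 0) => /L1_int/(_ mA).
by apply: eq_integrable => // x _ /=; rewrite addr0.
Qed.

Lemma Rint_additive f : L1 f -> set_additive (fun A => \int[mu]_(x in A) f x).
Proof.
move=> fi A B mA mB AB; rewrite Rintegral_setU//; last exact/disj_set2P.
by apply: L1_int => //; exact: measurableU.
Qed.

(** Absolute continuity of the integral, as the measures of the sets tend to 0. It supplies the
    majorants used for all limits of set functions. *)
Lemma Rint_cont0 f : L1 f -> cont_at_set0 (fun A => \int[mu]_(x in A) `|f x|).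
Proof.
move=> fi F mF niF F0; apply/cvgrPdist_lt => e e0.
have [r [r0 hr]] := integral_normr_continuous fi e0.
have : mu (F n) @[n --> \oo] --> mu (\bigcap_n F n).
  apply: nonincreasing_cvg_mu => //; last by rewrite F0.
  by rewrite ltey_eq fin_num_measure.
rewrite F0 measure0 => /fine_cvgP[_] /cvgrPdist_lt/(_ _ r0); apply: filterS => n /=.
rewrite !sub0r !normrN ger0_norm ?fine_ge0// => mur.
rewrite ger0_norm ?Rintegral_ge0//; apply: hr => //.
by rewrite -[ltLHS]fineK ?fin_num_measure.
Qed.

Lemma normr_Rint f A : L1 f -> measurable A ->
  `|\int[mu]_(x in A) f x| <= \int[mu]_(x in A) `|f x|.
Proof. by move=> fi mA; apply: le_normr_Rintegral => //; exact: L1_int. Qed.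

Lemma Rint_le f g A : L1 f -> L1 g -> measurable A ->
  (forall x, A x -> f x <= g x) -> \int[mu]_(x in A) f x <= \int[mu]_(x in A) g x.
Proof. by move=> fi gi mA; apply: le_Rintegral => //; exact: L1_int. Qed.

(** Tested on the set where the inequality fails: there f - g is positive but its integral is at
    most 0, so the set is null. *)
Lemma setwise_le_ae f g : L1 f -> L1 g ->
  (forall A, measurable A -> \int[mu]_(x in A) f x <= \int[mu]_(x in A) g x) ->
  {ae mu, forall x, f x <= g x}.
Proof.
move=> fi gi fg.
pose A := [set x | g x < f x].
have mA : measurable A.
  rewrite -[A]setTI (_ : A = [set x | ((g x)%:E < (f x)%:E)%E])//.
  by apply: measurable_lte => //; exact: (measurable_int mu).
have L1h := L1_lin (-1) gi fi.
have h0 : (\int[mu]_(x in A) `|(-1 * g x + f x)%:E| = 0)%E.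
  under eq_integral => x.
    rewrite inE /A /= => gf.
    rewrite ger0_norm; last lra.
    over.
  rewrite -EFin_Rint// Rint_lin//; congr EFin.
  apply/eqP; rewrite eq_le; apply/andP; split.
    by have := fg _ mA; lra.
  rewrite -Rint_lin//; apply: Rintegral_ge0 => x; rewrite /A /=; lra.
have := ae_eq_integral_abs mu mA (measurable_int _ (L1_int L1h mA)).
move=> [/(_ h0) + _]; apply: filterS => x hx.
rewrite leNgt; apply/negP => gf; move: (hx gf) => /= -[]; lra.
Qed.

Lemma ae_le_Rint f g A : L1 f -> L1 g -> measurable A ->
  {ae mu, forall x, f x <= g x} ->
  \int[mu]_(x in A) f x <= \int[mu]_(x in A) g x.
Proof.
move=> fi gi mA fg.
have L1h := L1_lin (-1) fi gi.
suff : \int[mu]_(x in A) (-1 * f x + g x) = \int[mu]_(x in A) `|-1 * f x + g x|.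
  rewrite Rint_lin// => e.
  have : 0 <= \int[mu]_(x in A) `|-1 * f x + g x| by exact: Rintegral_ge0.
  by rewrite -e; lra.
congr fine; apply: ae_eq_integral => //.
- by have /measurable_int := L1_int L1h mA.
- by have /measurable_int := L1_int (L1_norm L1h) mA.
- by apply: filterS fg => x fgx _; congr EFin; rewrite ger0_norm//; lra.
Qed.

End Setwise.

Lemma cvg_sumr (R : realType) (S I : Type) (F : set_system S) (r : seq I)
    (P : pred I) (u : I -> S -> R) (l : I -> R) : Filter F ->
  (forall i, P i -> u i x @[x --> F] --> l i) ->
  \sum_(i <- r | P i) u i x @[x --> F] --> \sum_(i <- r | P i) l i.
Proof.
move=> FF ul; elim: r => [|i r ih].
  by rewrite big_nil; under eq_fun do rewrite big_nil; exact: cvg_cst.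
rewrite big_cons; under eq_fun do rewrite big_cons.
by case: ifPn => // Pi; apply: cvgD => //; exact: ul.
Qed.

Section AdditiveSetFunctions.
Context d (T : measurableType d) (R : realType).
Implicit Types (nu m : set T -> R) (A B : set T) (F : (set T)^nat).

Lemma set_additive0 nu : set_additive nu -> nu set0 = 0.
Proof.
move=> /(_ set0 set0 measurable0 measurable0).
by rewrite setU0 set0I => /(_ erefl); lra.
Qed.

Lemma set_additiveD nu A B : set_additive nu -> measurable A -> measurable B ->
  B `<=` A -> nu (A `\` B) = nu A - nu B.
Proof.
move=> nuA mA mB BA; rewrite -[in nu A](setDUK BA) nuA//; first lra.
  exact: measurableD.
by rewrite setDIK.
Qed.

Lemma set_additive_bigsetU nu F n : set_additive nu ->
  (forall k, measurable (F k)) -> trivIset setT F ->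
  nu (\big[setU/set0]_(k < n) F k) = \sum_(k < n) nu (F k).
Proof.
move=> nuA mF tF; elim: n => [|n ih]; first by rewrite !big_ord0 set_additive0.
rewrite !big_ord_recr/= nuA ?ih//; first exact: bigsetU_measurable.
rewrite -bigcup_mkord; apply/seteqP; split => // x [[k /= kn Fkx] Fnx].
have kn' : k = n by apply: tF => //; exists x.
by rewrite kn' ltnn in kn.
Qed.

Lemma cont_at_set0_tail m F : cont_at_set0 m -> (forall k, measurable (F k)) ->
  m (\bigcup_k F k `\` \big[setU/set0]_(k < n) F k) @[n --> \oo] --> 0.
Proof.
move=> m0 mF; apply: m0 => [n||].
- by apply: measurableD; [exact: bigcupT_measurable|exact: bigsetU_measurable].
- move=> n k nk; apply/subsetPset => x [Fx nFx]; split => //.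
  apply: contra_not nFx; rewrite -!bigcup_mkord => -[i /= ni Fix].
  by exists i => //=; exact: leq_trans nk.
- apply/seteqP; split => // x xF.
  have [[k _ Fkx] _] := xF 0%N I.
  have [_] := xF k.+1 I; apply.
  by rewrite -bigcup_mkord; exists k => //=.
Qed.

Lemma set_additive_tail nu F n : set_additive nu ->
  (forall k, measurable (F k)) -> trivIset setT F ->
  nu (\bigcup_k F k `\` \big[setU/set0]_(k < n) F k) =
  nu (\bigcup_k F k) - \sum_(k < n) nu (F k).
Proof.
move=> nuA mF tF; rewrite set_additiveD//.
- by rewrite set_additive_bigsetU.
- exact: bigcupT_measurable.
- exact: bigsetU_measurable.
- by rewrite -bigcup_mkord => x [k _ Fkx]; exists k.
Qed.

Lemma set_additive_bigcup nu m F : set_additive nu -> cont_at_set0 m ->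
  (forall A, measurable A -> `|nu A| <= m A) ->
  (forall k, measurable (F k)) -> trivIset setT F ->
  \sum_(k < n) nu (F k) @[n --> \oo] --> nu (\bigcup_k F k).
Proof.
move=> nuA m0 num mF tF; apply/cvgrPdist_lt => e e0.
have /cvgrPdist_lt/(_ _ e0) := cont_at_set0_tail m0 mF.
apply: filterS => n /=; rewrite sub0r normrN; apply: le_lt_trans.
rewrite -set_additive_tail//; apply: le_trans (ler_norm _); apply: num.
by apply: measurableD; [exact: bigcupT_measurable|exact: bigsetU_measurable].
Qed.

(** Dynkin's argument: additivity handles complements, and for a disjoint union the common majorant
    [m] makes the tails small uniformly in n, so that a finite sum decides. *)
Lemma dominated_setwise_cvg (nu_ : nat -> set T -> R) nu m (G : set (set T)) :
  @measurable _ T = <<s G >> -> setI_closed G ->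
  (forall n, set_additive (nu_ n)) -> set_additive nu -> cont_at_set0 m ->
  (forall n A, measurable A -> `|nu_ n A| <= m A) ->
  (forall A, measurable A -> `|nu A| <= m A) ->
  nu_ n setT @[n --> \oo] --> nu setT ->
  (forall A, G A -> nu_ n A @[n --> \oo] --> nu A) ->
  forall A, measurable A -> nu_ n A @[n --> \oo] --> nu A.
Proof.
move=> GE GI nuA_ nuA m0 num_ num nuT nuG A; rewrite GE => mA.
apply: (dynkin_induction GE GI nuT nuG) mA.
- move=> S mS nuS; rewrite -setTD set_additiveD//.
  under eq_fun do rewrite set_additiveD//.
  exact: cvgB.
- move=> F mF tF nuF; apply/cvgrPdist_lt => e e0.
  (* One third for the first N sets, one for the tail under [nu] and one for the tail under
     [nu_ n]. *)
  have e3 : 0 < e / 3 by lra.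
  have /cvgrPdist_lt/(_ _ e3)/filter_ex[N] := cont_at_set0_tail m0 mF.
  set D := _ `\` _; rewrite /= sub0r normrN => /(le_lt_trans (ler_norm _)) mD.
  have mmD : measurable D.
    by apply: measurableD; [exact: bigcupT_measurable|exact: bigsetU_measurable].
  have cvgN : \sum_(k < N) nu_ n (F k) @[n --> \oo] --> \sum_(k < N) nu (F k).
    by apply: cvg_sumr => k _; exact: nuF.
  move/cvgrPdist_lt : cvgN => /(_ _ e3); apply: filterS => n /= nuN.
  have nuD := set_additive_tail N nuA mF tF.
  have nuD_ := set_additive_tail N (nuA_ n) mF tF.
  have := num _ mmD; have := num_ n _ mmD.
  rewrite nuD nuD_; move: nuN mD; rewrite !ltr_norml !ler_norml.
  by move=> /andP[? ?] ? /andP[? ?] /andP[? ?]; apply/andP; split; lra.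
Qed.

End AdditiveSetFunctions.

Section RadonNikodym.
Context d (T : measurableType d) (R : realType).
Variable mu : {finite_measure set T -> \bar R}.
Local Notation L1 f := (mu.-integrable setT (EFin \o f)).

(** The bound gives both countable additivity and absolute continuity with respect to [mu], so the
    Radon-Nikodym theorem applies to [nu]. *)
Lemma dominated_density (nu : set T -> R) (g : T -> R) : L1 g ->
  set_additive nu ->
  (forall A, measurable A -> `|nu A| <= \int[mu]_(x in A) `|g x|) ->
  exists2 f, L1 f & forall A, measurable A -> nu A = \int[mu]_(x in A) f x.
Proof.
move=> gi nuA nug.
pose nuE A := (nu A)%:E.
have nuE0 : nuE set0 = 0%E by rewrite /nuE set_additive0.
have nuEfin A : measurable A -> nuE A \is a fin_num by [].
have nuEs : semi_sigma_additive nuE.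
  move=> F mF tF _; apply: cvg_EFin; first by apply: nearW => n; rewrite sumEFin.
  under eq_fun do rewrite /= sumEFin/= big_mkord.
  exact: (set_additive_bigcup nuA (Rint_cont0 gi)).
pose ch : {charge set T -> \bar R} :=
  HB.pack nuE (isCharge.Build _ _ _ nuE nuE0 nuEfin nuEs).
have chmu : ch `<< mu.
  apply/null_content_dominatesP => A mA muA0.
  rewrite /= /nuE; congr EFin; apply/normr0_eq0/eqP; rewrite eq_le normr_ge0 andbT.
  rewrite (le_trans (nug _ mA))// -lee_fin EFin_Rint//; last exact: L1_norm.
  rewrite null_set_integral//; apply/measurable_funTS.
  by have /measurable_int := L1_norm gi.
pose f x := fine (Radon_Nikodym ch mu x).
have fE : EFin \o f = Radon_Nikodym ch mu.
  by apply/funext => x /=; rewrite fineK//; exact: Radon_Nikodym_fin_num.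
have fi : L1 f by rewrite fE; exact: Radon_Nikodym_integrable.
exists f => // A mA; apply/EFin_inj; rewrite EFin_Rint//.
rewrite -[LHS]/(ch A) (Radon_Nikodym_integral chmu mA).
by apply: eq_integral => x _; rewrite -fE.
Qed.

End RadonNikodym.

(** * Bounded functionals on L^1 *)

Section BoundedMeasurable.
Context d (T : measurableType d) (R : realType).
Implicit Types f g : T -> R.

Definition bounded_measurable f :=
  measurable_fun setT f /\ exists C, forall x, `|f x| <= C.

Lemma bounded_measurable_indic (A : set T) : measurable A ->
  bounded_measurable (\1_A : T -> R).
Proof.
move=> mA; split; first exact: measurable_indic.
by exists 1 => x; rewrite indicE; case: (_ \in _); rewrite ?normr1 ?normr0.
Qed.

Lemma bounded_measurable_lin a f g : bounded_measurable f ->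
  bounded_measurable g -> bounded_measurable (fun x => a * f x + g x).
Proof.
move=> [mf [C fC]] [mg [D gD]]; split.
  by apply: measurable_funD => //; exact: measurable_funM.
exists (`|a| * C + D) => x.
rewrite (le_trans (ler_normD _ _))// lerD// normrM.
by rewrite ler_wpM2l.
Qed.

(** An induction principle: a bounded measurable function is a uniform limit of staircases, which
    are combinations of indicators of its superlevel sets. *)
Lemma bounded_measurable_ind (P : (T -> R) -> Prop) :
  (forall A, measurable A -> P \1_A) ->
  (forall a f g, bounded_measurable f -> bounded_measurable g ->
     P f -> P g -> P (fun x => a * f x + g x)) ->
  (forall f, bounded_measurable f ->
     (forall e, 0 < e -> exists g,
        [/\ bounded_measurable g, P g & forall x, `|f x - g x| <= e]) -> P f) ->
  forall f, bounded_measurable f -> P f.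
Proof.
move=> P1 Plin Punif f bf; apply: (Punif _ bf) => e e0.
have [mf [C fC]] := bf.
pose A n := [set x | - C + n.+1%:R * e <= f x].
have mA n : measurable (A n).
  rewrite -[A n]setTI; apply: measurable_fun_le => //.
(* g x = - C + \sum_(1 <= k < n.+1) e * \1_[set x | f x >= - C + k%:R * e] x *)
suff H n : exists g, [/\ bounded_measurable g, P g & forall x,
    [/\ g x <= f x, f x < - C + n%:R * e -> f x <= g x + e
      & - C + n%:R * e <= f x -> g x = - C + n%:R * e]].
  (* With this N the level - C + N e exceeds C, so f lies below it everywhere. *)
  have [N hN] : exists N : nat, 2 * C < N%:R * e.
    exists (Num.bound `|2 * C / e|); rewrite -ltr_pdivrMr//.
    exact: le_lt_trans (ler_norm _) (archi_boundP (normr_ge0 _)).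
  have [g [bg Pg hg]] := H N; exists g; split => // x.
  have [gf fg _] := hg x; have := fC x; rewrite ler_norml => /andP[_ fxC].
  have {}fg : f x <= g x + e by apply: fg; lra.
  by rewrite ger0_norm; lra.
elim: n => [|n [g [bg Pg hg]]].
  (* The constant - C, written as a combination of indicators so that [Plin] applies. *)
  exists (fun x => - C * \1_setT x + \1_set0 x); split.
  - by apply: bounded_measurable_lin; exact: bounded_measurable_indic.
  - by apply: Plin; do ?exact: bounded_measurable_indic; exact: P1.
  - move=> x; rewrite !indicE in_setT in_set0 /= mulr1 addr0 mul0r addr0.
    by have := fC x; rewrite ler_norml => /andP[? ?]; split => //; lra.
exists (fun x => e * \1_(A n) x + g x); split.
- by apply: bounded_measurable_lin => //; exact: bounded_measurable_indic.
- by apply: Plin => //; [exact: bounded_measurable_indic|exact: P1].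
- move=> x; have [gf fg gE] := hg x.
  have nS : n.+1%:R * e = n%:R * e + e by rewrite -natr1 mulrDl mul1r.
  rewrite indicE; have [/set_mem|/negP nAx] := boolP (x \in A n); rewrite /A /= nS.
    move=> Anx; rewrite mulr1.
    have {}gE : g x = - C + n%:R * e by apply: gE; lra.
    by split; lra.
  have {}nAx : f x < - C + n.+1%:R * e.
    by rewrite ltNge; apply/negP => h; apply: nAx; apply/mem_set.
  rewrite nS in nAx; rewrite mulr0 add0r; split => // [_|]; last lra.
  have [fn|fn] := ltP (f x) (- C + n%:R * e); first exact: fg.
  by have := gE fn; lra.
Qed.

End BoundedMeasurable.

(** * Bounded functions as functionals on L^1 of a finite measure *)

Section Duality.
Import HBSimple.
Context d (T : measurableType d) (R : realType).
Variable mu : {finite_measure set T -> \bar R}.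
Local Notation L1 f := (mu.-integrable setT (EFin \o f)).
Implicit Types f g : T -> R.

Lemma L1_bounded_measurable f : bounded_measurable f -> L1 f.
Proof. by move=> [mf [C fC]]; exact: L1_bounded fC. Qed.

Lemma Rint_indicM f (A : set T) : measurable A ->
  \int[mu]_x (\1_A x * f x) = \int[mu]_(x in A) f x.
Proof.
move=> mA; rewrite [RHS]Rintegral_mkcond; apply: eq_Rintegral => x _.
by rewrite patchE indicE; case: (_ \in _); rewrite ?mul1r ?mul0r.
Qed.

Lemma L1_boundedM f g : bounded_measurable f -> L1 g -> L1 (fun x => f x * g x).
Proof. by move=> [mf [C fC]]; exact: L1_bM fC. Qed.

Lemma setwise_ge0_norm f : L1 f ->
  (forall A, measurable A -> 0 <= \int[mu]_(x in A) f x) ->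
  forall A, measurable A -> \int[mu]_(x in A) `|f x| = \int[mu]_(x in A) f x.
Proof.
move=> fi f0 A mA; apply/eqP; rewrite eq_le; apply/andP; split.
  apply: ae_le_Rint => //; first exact: L1_norm.
  have : {ae mu, forall x, 0 <= f x}.
    apply: setwise_le_ae => //; first exact: L1_cst.
    by move=> B mB; rewrite Rintegral_cst// mul0r f0.
  by apply: filterS => x fx0; rewrite ger0_norm.
by apply: Rint_le => //; [exact: L1_norm|move=> x _; exact: ler_norm].
Qed.

Lemma Rint_M_le (C : R) (h f : T -> R) : measurable_fun setT h ->
  (forall x, `|h x| <= C) -> L1 f ->
  `|\int[mu]_x (h x * f x)| <= C * \int[mu]_x `|f x|.
Proof.
move=> mh hC fi; have hfi := L1_bM mh hC fi.
rewrite (le_trans (normr_Rint hfi measurableT))//.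
rewrite -RintegralZl//; last exact: L1_norm.
apply: Rint_le => //; first exact: L1_norm.
  have := L1_lin C (L1_norm fi) (L1_cst mu 0).
  by apply: eq_integrable => // x _ /=; rewrite addr0.
by move=> x _; rewrite normrM ler_wpM2r.
Qed.

(** Setwise convergence is the case of indicators. The closure under uniform limits works because
    the norms of all [f_ n] and of f are at most the integral of g. *)
Lemma setwise_cvg_boundedM (f_ : nat -> T -> R) f g b :
  L1 g -> L1 f -> (forall n, L1 (f_ n)) ->
  (forall n A, measurable A ->
     0 <= \int[mu]_(x in A) f_ n x <= \int[mu]_(x in A) g x) ->
  (forall A, measurable A ->
     \int[mu]_(x in A) f_ n x @[n --> \oo] --> \int[mu]_(x in A) f x) ->
  bounded_measurable b ->
  \int[mu]_x (b x * f_ n x) @[n --> \oo] --> \int[mu]_x (b x * f x).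
Proof.
move=> gi fi fi_ f0g_ cvgf; move: b.
have f0g A : measurable A ->
    0 <= \int[mu]_(x in A) f x <= \int[mu]_(x in A) g x.
  move=> mA; have fA := cvgf A mA; apply/andP; split.
    by apply: (cvgr_to_ge fA); apply: nearW => n; have /andP[] := f0g_ n A mA.
  by apply: (cvgr_to_le fA); apply: nearW => n; have /andP[] := f0g_ n A mA.
apply: bounded_measurable_ind => [A mA|a b c bb bc IHb IHc|b bb hb].
- by rewrite Rint_indicM//; under eq_fun do rewrite Rint_indicM//; exact: cvgf.
- have E h : L1 h -> \int[mu]_x ((a * b x + c x) * h x) =
      a * \int[mu]_x (b x * h x) + \int[mu]_x (c x * h x).
    move=> hi; rewrite -Rint_lin//; try exact: L1_boundedM.
    by apply: eq_Rintegral => x _; ring.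
  rewrite E//; under eq_fun do rewrite E//.
  by apply: cvgD => //; apply: cvgMr.
- apply/cvgrPdist_le => e e0.
  pose D := \int[mu]_x g x.
  have D0 : 0 <= D by have /andP[/le_trans h /h] := f0g setT measurableT.
  (* Replacing b by c then costs at most e / 3 for f and for each [f_ n]; D + 1 is used since D may
     be 0. *)
  have e' : 0 < e / (3 * (D + 1)) by rewrite divr_gt0//; lra.
  have [c [bc cvgc bcle]] := hb _ e'.
  have eD : e / (3 * (D + 1)) * D <= e / 3.
    rewrite invfM mulrA -[leRHS]mulr1 -mulrA ler_wpM2l//; first lra.
    by rewrite mulrC ler_pdivrMr; lra.
  have dist h : L1 h -> (forall A, measurable A ->
      0 <= \int[mu]_(x in A) h x <= \int[mu]_(x in A) g x) ->
      `|\int[mu]_x (b x * h x) - \int[mu]_x (c x * h x)| <= e / 3.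
    move=> hi h0g; rewrite -RintegralB//; try exact: L1_boundedM.
    under eq_Rintegral do rewrite -mulrBl.
    apply: le_trans eD; apply: le_trans (Rint_M_le _ bcle hi) _.
      by apply: measurable_funB; [case: bb|case: bc].
    rewrite ler_wpM2l ?(ltW e')// setwise_ge0_norm//.
      by have /andP[] := h0g _ measurableT.
    by move=> A /h0g/andP[].
  have e3 : 0 < e / 3 by lra.
  move/cvgrPdist_le : cvgc => /(_ _ e3); apply: filterS => n.
  have := dist _ fi f0g; have := dist _ (fi_ n) (f0g_ n).
  rewrite !ler_norml => /andP[? ?] /andP[? ?] /andP[? ?]; apply/andP; split; lra.
Qed.

(** The representation of the dual of L^1 by bounded functions: on indicators [psi] is an additive
    set function dominated by a multiple of [mu], and its density represents [psi] on all of L^1 by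
    approximation. *)
Lemma L1_dual (psi : (T -> R) -> R) (C : R) :
  (forall a f g, L1 f -> L1 g ->
     psi (fun x => a * f x + g x) = a * psi f + psi g) ->
  (forall f, L1 f -> `|psi f| <= C * \int[mu]_x `|f x|) ->
  exists2 b, bounded_measurable b &
    forall f, L1 f -> psi f = \int[mu]_x (b x * f x).
Proof.
move=> psilin psiC0; pose c := `|C|.
have psiC f : L1 f -> `|psi f| <= c * \int[mu]_x `|f x|.
  move=> fi; rewrite (le_trans (psiC0 _ fi))// ler_wpM2r ?ler_norm//.
  exact: Rintegral_ge0.
have c0 : 0 <= c by exact: normr_ge0.
pose nu (A : set T) := psi \1_A.
have nuA : set_additive nu.
  move=> A B mA mB AB; rewrite /nu -[psi \1_A]mul1r -psilin; try exact: L1_indic.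
  congr psi; apply/funext => x; rewrite mul1r !indicE.
  rewrite in_setU; have [/set_mem Ax|_] := boolP (x \in A) => /=; last by rewrite add0r.
  rewrite (_ : x \in B = false) ?addr0//; apply/negbTE/negP => /set_mem Bx.
  by have : (A `&` B) x by []; rewrite AB.
have nuc A : measurable A -> `|nu A| <= \int[mu]_(x in A) c.
  move=> mA; rewrite (le_trans (psiC _ (L1_indic mu mA)))//.
  rewrite Rintegral_cst// ler_wpM2l//.
  have := Rint_indicM (fun=> 1) mA; rewrite Rintegral_cst// mul1r => <-.
  rewrite le_eqVlt; apply/orP; left; apply/eqP; apply: eq_Rintegral => x _.
  by rewrite mulr1 ger0_norm// indicE.
have [|b0 b0i b0E] := dominated_density (L1_cst mu c) nuA.
  by move=> A mA; under eq_Rintegral do rewrite ger0_norm//; exact: nuc.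
have b0c : {ae mu, forall x, b0 x <= c}.
  apply: setwise_le_ae => //; first exact: L1_cst.
  by move=> A mA; rewrite -b0E// (le_trans (ler_norm _))// nuc.
have b0Nc : {ae mu, forall x, - c <= b0 x}.
  apply: setwise_le_ae => //; first exact: L1_cst.
  move=> A mA; rewrite -b0E// Rintegral_cst// mulNr -Rintegral_cst//.
  by have := nuc _ mA; rewrite ler_norml => /andP[].
(* The density is bounded by c only almost everywhere; clipping it makes the bound hold at every
   point. *)
pose b x := Num.max (- c) (Num.min (b0 x) c).
have mb : measurable_fun setT b.
  apply: measurable_maxr => //; apply: measurable_minr => //.
  exact: L1_measurable b0i.
have bc x : `|b x| <= c.
  by rewrite ler_norml /b le_max lexx/= ge_max ge_min lexx orbT andbT; lra.
have bb : bounded_measurable b by split => //; exists c.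
have bi := L1_bounded_measurable bb.
have nub A : measurable A -> nu A = \int[mu]_(x in A) b x.
  have bb0 : {ae mu, forall x, b x = b0 x}.
    apply: filterS2 b0c b0Nc => x h1 h2; rewrite /b min_l// max_r//.
  move=> mA; rewrite b0E//; apply/eqP; rewrite eq_le.
  by apply/andP; split; apply: ae_le_Rint => //; apply: filterS bb0 => x ->.
(* Both functionals are Lipschitz with constant c for the norm, so agreement at g gives near
   agreement at every f close to g. *)
have dist f g : L1 f -> L1 g -> psi g = \int[mu]_x (b x * g x) ->
    `|psi f - \int[mu]_x (b x * f x)| <= 2 * c * \int[mu]_x `|f x - g x|.
  move=> fi gi gE; have hi := L1_lin (-1) gi fi.
  have -> : \int[mu]_x `|f x - g x| = \int[mu]_x `|-1 * g x + f x|.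
    by apply: eq_Rintegral => x _; congr `|_|; ring.
  have := psiC _ hi; rewrite psilin// => h1.
  have := Rint_M_le mb bc hi.
  have -> : \int[mu]_x (b x * (-1 * g x + f x)) =
      -1 * \int[mu]_x (b x * g x) + \int[mu]_x (b x * f x).
    rewrite -Rint_lin//; try exact: L1_boundedM.
    by apply: eq_Rintegral => x _; ring.
  move: h1; rewrite gE; set I1 := \int[mu]_x _; set I2 := \int[mu]_x _.
  set I3 := \int[mu]_x _.
  by rewrite !ler_norml => /andP[? ?] /andP[? ?]; apply/andP; split; lra.
have le0 x : (forall e, 0 < e -> `|x| <= e) -> x = 0 :> R.
  move=> h; apply/normr0_eq0/le_anti; rewrite normr_ge0 andbT.
  by apply/ler_addgt0Pl => e e0; rewrite addr0 h.
have bounded f : bounded_measurable f -> psi f = \int[mu]_x (b x * f x).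
  move: f; apply: bounded_measurable_ind => [A mA|a f g bf bg fE gE|f bf hf].
  - rewrite -/(nu A) nub// -Rint_indicM//.
    by apply: eq_Rintegral => x _; rewrite mulrC.
  - have fi := L1_bounded_measurable bf; have gi := L1_bounded_measurable bg.
    rewrite psilin// fE gE -Rint_lin//; try exact: L1_boundedM.
    by apply: eq_Rintegral => x _; ring.
  - have fi := L1_bounded_measurable bf.
    apply/subr0_eq/le0 => e e0.
    pose D := 2 * c * fine (mu setT).
    have D0 : 0 <= D by rewrite mulr_ge0// ?fine_ge0//; lra.
    have e' : 0 < e / (D + 1) by rewrite divr_gt0//; lra.
    have [g [bg gE fg]] := hf _ e'; have gi := L1_bounded_measurable bg.
    rewrite (le_trans (dist _ _ fi gi gE))//.
    apply: (@le_trans _ _ (D * (e / (D + 1)))).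
      rewrite /D -[leRHS]mulrA ler_wpM2l//; first lra.
      rewrite mulrC -Rintegral_cst//; apply: Rint_le => //; last first.
        exact: L1_cst.
      have := L1_norm (L1_lin (-1) gi fi).
      by apply: eq_integrable => // x _ /=; rewrite mulN1r addrC.
    by rewrite mulrCA -[leRHS]mulr1 ler_wpM2l ?(ltW e0)// ler_pdivrMr; lra.
exists b => // f fi; apply/subr0_eq/le0 => e e0.
(* Uniform approximation reaches only bounded functions; an unbounded f is approximated in norm by
   simple ones. *)
have [g_ [gi_ _ fg]] := approximation_sfun_integrable measurableT fi.
have e' : 0 < e / (2 * c + 1) by rewrite divr_gt0//; lra.
move: fg => /fine_cvgP[_] /cvgrPdist_le/(_ _ e')/filter_ex[n].
rewrite /= sub0r normrN => fgn.
have bg : bounded_measurable (g_ n : T -> R).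
  split => //; have [M [_ hM]] := simple_bounded (g_ n).
  by exists (M + 1) => x; apply: hM; rewrite ?ltrDl.
rewrite (le_trans (dist _ (g_ n : T -> R) fi (gi_ n) (bounded _ bg)))//.
apply: (@le_trans _ _ (2 * c * (e / (2 * c + 1)))).
  by rewrite ler_wpM2l//; [lra|exact: le_trans (ler_norm _) fgn].
by rewrite mulrCA -[leRHS]mulr1 ler_wpM2l ?(ltW e0)// ler_pdivrMr; lra.
Qed.

End Duality.

(** * Weak sequential compactness of order intervals *)

(** By compactness of the segment the image of U has a cluster point, and an ultrafilter converges
    to each of its cluster points. *)
Lemma ultra_bounded_cvg (R : realType) (S : Type) (U : set_system S)
    (a : S -> R) (b c : R) : UltraFilter U -> (forall n, b <= a n <= c) ->
  exists l : R, a n @[n --> U] --> l.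
Proof.
move=> UU abc.
have UF : ProperFilter U by exact: ultra_proper.
have [|p [_ pcl]] := @segment_compact R b c (a @ U).
  by apply: nearW => n; rewrite /= in_itv/= abc.
exists p => V pV.
have [//|VU] := in_ultra_setVsetC (a @^-1` V) UU.
by have [x [nVx Vx]] := pcl (~` V) V VU pV.
Qed.

(** The first m + 1 sequences are simultaneously within 1/(m + 1) of their limits on a set of U, and
    this set contains some index at least m, taken as [phi m]. The condition n <= [phi n] replaces
    strict monotonicity: it suffices for limits at infinity. *)
Lemma ultra_diagonal (R : realType) (U : set_system nat)
    (c : nat -> nat -> R) (l : nat -> R) :
  ProperFilter U -> \oo `<=` U ->
  (forall j, c j n @[n --> U] --> l j) ->
  exists2 phi : nat -> nat, forall n, (n <= phi n)%N &
    forall j, c j (phi n) @[n --> \oo] --> l j.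
Proof.
move=> UF Uoo cl.
have H m : exists n, (m <= n)%N /\
    forall j, (j <= m)%N -> `|l j - c j n| < m.+1%:R^-1.
  have Hm : U [set n | (m <= n)%N].
    by apply: Uoo; exists m.
  suff Hj k : U [set n | forall j, (j <= k)%N -> `|l j - c j n| < m.+1%:R^-1].
    have [n [mn nj]] := filter_ex (filterI Hm (Hj m)).
    by exists n.
  have m0 : (0 : R) < m.+1%:R^-1 by rewrite invr_gt0.
  elim: k => [|k ih].
    have /cvgrPdist_lt/(_ _ m0) := cl 0%N.
    by apply: filterS => n + j; rewrite leqn0 => + /eqP ->.
  have /cvgrPdist_lt/(_ _ m0) := cl k.+1.
  apply: filterS2 ih => n h1 h2 j; rewrite leq_eqVlt => /orP[/eqP ->//|].
  exact: h1.
have [phi hphi] := choice H.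
exists phi => [n|j]; first by have [] := hphi n.
apply/cvgrPdist_lt => e e0; near=> n.
have [_ h] := hphi n.
apply: lt_trans (h j _) _; near: n; first exact: nbhs_infty_ge.
exact: near_infty_natSinv_lt (PosNum e0).
Unshelve. all: by end_near. Qed.

Section Subsequence.
Context d (T : measurableType d) (R : realType).
Variable mu : {finite_measure set T -> \bar R}.
Local Notation L1 f := (mu.-integrable setT (EFin \o f)).

(** Along the ultrafilter, limits exist on all measurable sets at once, and being dominated they
    have densities. Only then is the ultrafilter traded for a sequence, on the sets of [G], whence
    [dominated_setwise_cvg] recovers all other sets. *)
Lemma dominated_setwise_subsequence (K : countType)
    (f : K -> nat -> T -> R) (g : K -> T -> R) (G : nat -> set T) :
  @measurable _ T = <<s range G >> -> setI_closed (range G) ->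
  (forall k n, L1 (f k n)) -> (forall k, L1 (g k)) ->
  (forall k n A, measurable A ->
     0 <= \int[mu]_(x in A) f k n x <= \int[mu]_(x in A) g k x) ->
  exists2 phi : nat -> nat, forall n, (n <= phi n)%N &
  exists2 F : K -> T -> R, forall k, L1 (F k) &
    forall k A, measurable A ->
      \int[mu]_(x in A) f k (phi n) x @[n --> \oo] --> \int[mu]_(x in A) F k x.
Proof.
move=> GE GI fi gi f0g.
have [U [UU Uoo]] := ultraFilterLemma (eventually_filter : ProperFilter \oo).
have UF : ProperFilter U by exact: ultra_proper.
have hlim k A : exists l : R, measurable A -> \int[mu]_(x in A) f k n x @[n --> U] --> l.
  have [mA|] := pselect (measurable A); last by exists 0.
  by have [l hl] := ultra_bounded_cvg UU (fun n => f0g k n A mA); exists l.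
pose nu k A := sval (cid (hlim k A)).
have nuE k A : measurable A -> \int[mu]_(x in A) f k n x @[n --> U] --> nu k A.
  by rewrite /nu; case: cid.
have nuA k : set_additive (nu k).
  move=> A B mA mB AB; have mAB := measurableU _ _ mA mB.
  apply: (cvg_unique _ (nuE k _ mAB)) => //.
  rewrite (_ : (fun n => _) = (fun n => \int[mu]_(x in A) f k n x) \+
                              (fun n => \int[mu]_(x in B) f k n x)).
    by apply: cvgD; exact: nuE.
  by apply/funext => n; exact: Rint_additive.
have g_norm k A : measurable A ->
    \int[mu]_(x in A) g k x <= \int[mu]_(x in A) `|g k x|.
  by move=> mA; rewrite (le_trans (ler_norm _))// normr_Rint.
have nug k A : measurable A -> `|nu k A| <= \int[mu]_(x in A) `|g k x|.
  move=> mA; rewrite ger0_norm.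
    apply: (cvgr_to_le (nuE k A mA)); apply: nearW => n.
    by have /andP[_ h] := f0g k n A mA; rewrite (le_trans h)// g_norm.
  apply: (cvgr_to_ge (nuE k A mA)); apply: nearW => n.
  by have /andP[] := f0g k n A mA.
have /choice[F hF] : forall k, exists F, L1 F /\
    forall A, measurable A -> nu k A = \int[mu]_(x in A) F x.
  by move=> k; have [F ? ?] := dominated_density (gi k) (nuA k) (nug k); exists F.
(* [None] adds the whole space, where [dominated_setwise_cvg] requires convergence separately from
   [G]. *)
pose B (o : option nat) := if o is Some j then G j else setT.
have mB o : measurable (B o).
  case: o => [j|] //=; rewrite GE; apply: sub_gen_smallest; exact: imageT.
(* All pairs of a coordinate and a set are enumerated by one number p; a number that codes no pair
   gives the zero sequence. *)
pose c p n := if @choice.unpickle ((K * option nat)%type : countType) p is Some (k, o)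
  then \int[mu]_(x in B o) f k n x else 0.
pose l p := if @choice.unpickle ((K * option nat)%type : countType) p is Some (k, o)
  then nu k (B o) else 0.
have [|phi phi_ge hphi] := @ultra_diagonal _ U c l UF Uoo.
  move=> p; rewrite /c /l; case: (choice.unpickle _) => [[k o]|]; first exact: nuE.
  exact: cvg_cst.
have hphiB k o : \int[mu]_(x in B o) f k (phi n) x @[n --> \oo] --> nu k (B o).
  by have := hphi (choice.pickle (k, o)); rewrite /c /l choice.pickleK.
exists phi => //; exists F => [k|k A mA]; first by have [] := hF k.
have [_ hFk] := hF k; rewrite -hFk//.
apply: (dominated_setwise_cvg GE GI (nu_ := fun n A => \int[mu]_(x in A) f k (phi n) x)
  _ (nuA k) (Rint_cont0 (gi k)) _ (nug k)) mA => [n|n C mC||C [j _ <-]].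
- exact: Rint_additive.
- have /andP[h1 h2] := f0g k (phi n) C mC.
  by rewrite ger0_norm// (le_trans h2)// g_norm.
- exact: (hphiB k None).
- exact: (hphiB k (Some j)).
Qed.

End Subsequence.

(** * A countable pi-system generating the Borel sets *)

Section RationalRays.
Context (R : realType).

Definition rational_ray (j : nat) : set (measurableTypeR R) :=
  if @choice.unpickle rat j is Some q then [set x | x <= ratr q] else set0.

Lemma rational_rayI : setI_closed (range rational_ray).
Proof.
move=> _ _ [i _ <-] [j _ <-]; rewrite /rational_ray.
case Ei: (choice.unpickle i) => [p|]; last first.
  by rewrite set0I; exists i => //; rewrite Ei.
case Ej: (choice.unpickle j) => [q|]; last first.
  by rewrite setI0; exists j => //; rewrite Ej.
pose r : rat := Num.min p q.
exists (choice.pickle r) => //; rewrite choice.pickleK /r; apply/seteqP; split => x /=.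
  have [pq|qp] := leP p q => xpq; split => //; apply: (le_trans xpq).
    by rewrite ler_rat.
  by rewrite ler_rat ltW.
by move=> [xp xq]; have [pq|qp] := leP p q.
Qed.

Lemma rational_rayE :
  @measurable _ (measurableTypeR R) = <<s range rational_ray >>.
Proof.
have msray j : <<s range rational_ray >> (rational_ray j).
  by apply: sub_gen_smallest; exact: imageT.
have ssa := smallest_sigma_algebra setT (range rational_ray).
apply/seteqP; split => A.
  have -> : @measurable _ (measurableTypeR R) = <<s @RGenOInfty.G R >>.
    exact: RGenOInfty.measurableE.
  apply: smallest_sub A => // _ [x ->].
  (* An open ray is the union of the complements of the rational rays ending to the right of x. *)
  rewrite (_ : `]x, +oo[%classic = \bigcup_j (if @choice.unpickle rat j is Some q then
      if x < ratr q then setT `\` rational_ray j else set0 else set0)).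
    case: ssa => s0 sC sU; apply: sU => j.
    by case: (choice.unpickle _) => // q; case: ifPn => // _; exact: sC.
  apply/seteqP; split => y /=; rewrite in_itv/= andbT.
    move=> xy; have [q] := rat_in_itvoo xy; rewrite in_itv/= => /andP[xq qy].
    have [j Ej] : exists j, choice.unpickle j = Some q.
      by exists (choice.pickle q); exact: choice.pickleK.
    exists j => //; rewrite /rational_ray Ej xq.
    by split => //=; apply/negP; rewrite -ltNge.
  move=> [j _]; rewrite /rational_ray; case: (choice.unpickle _) => // q; case: ifPn => // xq.
  by move=> [_ /negP]; rewrite -ltNge; exact: lt_trans.
apply: smallest_sub A; first exact: sigma_algebra_measurable.
move=> _ [j _ <-]; rewrite /rational_ray.
case: (choice.unpickle _) => [q|]; last first.
  exact: (@measurable0 _ (measurableTypeR R)).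
have -> : [set x | x <= ratr q] = `]-oo, (ratr q : R)]%classic.
  by apply/seteqP; split => x /=; rewrite in_itv.
by move: (ratr q) => r; exact: measurable_itv.
Qed.

End RationalRays.

(** * The network loading *)

Section Horizon.
Context (R : realType) (tf : R).
Local Notation L := (LH tf).
Local Notation L1 f := ((sigma tf).-integrable setT (EFin \o f)).

Lemma lebesgue_horizon_lty : (@lebesgue_measure R (horizon tf) < +oo)%E.
Proof.
by rewrite /horizon lebesgue_measure_itv; case: ifPn => // _; rewrite -EFinB ltry.
Qed.

(* [sigma tf] again, packed as a finite measure. *)
Definition finite_sigma : {finite_measure set (measurableTypeR R) -> \bar R} :=
  mfrestr (measurable_horizon tf) lebesgue_horizon_lty.

Lemma LH_L1 (f : L) : L1 f.
Proof.
have mf : measurable_fun setT f.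
  exact: (@measurable_funPT _ _ _ _ (repr (f : {mfun_ sigma tf, _ >-> _}))).
apply/Lfun1_integrable; rewrite inE; apply/andP; split; first by rewrite inE.
by rewrite inE /=; exact: Lebesgue_finite.
Qed.

Lemma Lnorm1E (f : L) : Defs.Lnorm1 f = (\int[sigma tf]_x `|f x|)%:E.
Proof.
rewrite /Defs.Lnorm1 hoelder.Lnorm1 (@EFin_Rint _ _ _ finite_sigma)//.
exact: (@L1_norm _ _ _ finite_sigma _ (LH_L1 f)).
Qed.

Lemma LH_of_L1 (f : R -> R) : L1 f ->
  exists F : L, {ae sigma tf, forall x, F x = f x}.
Proof.
move=> fi.
have mf : measurable_fun setT (f : measurableTypeR R -> measurableTypeR R).
  by have /measurable_EFinP := measurable_int _ fi.
pose f0 : {mfun measurableTypeR R >-> measurableTypeR R} :=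
  HB.pack (f : measurableTypeR R -> measurableTypeR R)
  (isMeasurableFun.Build _ _ _ _ (f : measurableTypeR R -> measurableTypeR R) mf).
pose mfunq := {mfun_ sigma tf, measurableTypeR R >-> measurableTypeR R}.
pose F0 : {mfun_ sigma tf, measurableTypeR R >-> measurableTypeR R} :=
  (\pi_mfunq f0)%qT.
have F0E : {ae sigma tf, forall x, F0 x = f x}.
  have : (repr F0 == f0 %[mod mfunq])%qT by rewrite reprK.
  rewrite eqmodE => /asboolP; apply: filterS => x.
  exact.
have F0n : finite_norm (sigma tf) 1 F0.
  rewrite /finite_norm hoelder.Lnorm1.
  have [_] := integrableP _ _ _ fi; apply: le_lt_trans.
  rewrite le_eqVlt; apply/orP; left; apply/eqP.
  apply: ge0_ae_eq_integral => //.
  - apply: measurableT_comp => //; apply/measurable_EFinP.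
    exact: (@measurable_funPT _ _ _ _ (repr F0)).
  - by apply: measurableT_comp => //; exact/measurable_EFinP.
  - by apply: filterS F0E => x fx _ /=; rewrite -fx.
pose F : L := HB.pack F0 (isFinLebesgue.Build _ _ _ _ _ _ F0 F0n).
by exists F.
Qed.

End Horizon.

(** * Arrival times, and loads as set functions *)

Section Load.
Context (R : realType) (tf : R) (tf_gt0 : 0 < tf).
Context (V : finType) (E : {set V * V}).
Local Notation L := (LH tf).
Local Notation H := (horizon tf).
Local Notation mu := (sigma tf).
Local Notation L1 f := ((sigma tf).-integrable setT (EFin \o f)).
Context (D : (edge E -> L) -> edge E -> R -> R) (u : edge E -> L).
Hypothesis exit_time_homo : forall e, {in H &,
  {homo exit_time D u e : s t / s <= t}}.
Hypothesis arrival_horizon : arrivals_in_horizon D u.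

Let mH : measurable (H : set (measurableTypeR R)) := measurable_horizon tf.

Lemma Rint_horizon (f : R -> R) (A : set (measurableTypeR R)) :
  L1 f -> measurable A ->
  \int[mu]_(x in A) f x = \int[mu]_(x in H `&` A) f x.
Proof.
move=> fi mA.
have mHA : measurable (H `&` A) by exact: measurableI.
have mAH : measurable (A `\` H) by exact: measurableD.
rewrite -[in LHS](setUIDK A H) setIC.
rewrite (@Rint_additive _ _ _ (finite_sigma tf) _ fi _ _ mHA mAH); last first.
  by apply/seteqP; split => // x [[Hx _] [_ /(_ Hx)]].
suff -> : \int[mu]_(x in A `\` H) f x = 0 by rewrite addr0.
rewrite /Rintegral null_set_integral//.
  have /measurable_int mf := fi; exact: measurable_funTS.
by rewrite [LHS]/(mrestr _ _ _) /mrestr setIC setDIK.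
Qed.

Section Arrival.
Variable w : walk E.
Local Notation A_ := (arrival D u (val w)).

Lemma arrivalS j : (j < size (val w))%N ->
  exists e, forall t, A_ j.+1 t = exit_time D u e (A_ j t).
Proof.
move=> jw; case Ew: (val w) jw => [//|e0 s] jw.
by exists (nth e0 (e0 :: s) j) => t; rewrite /arrival (take_nth e0)// foldl_rcons.
Qed.

Lemma arrival_homo j : (j <= size (val w))%N ->
  {in H &, {homo A_ j : s t / s <= t}}.
Proof.
elim: j => [_ s t _ _ st|j ih jw s t sH tH st]; first by rewrite /arrival take0.
have [e he] := arrivalS jw; rewrite !he.
have [sH' tH'] := (set_mem sH, set_mem tH).
by apply: exit_time_homo; rewrite ?inE; try (apply: arrival_horizon => //; exact: ltnW);
  apply: ih => //; exact: ltnW.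
Qed.

Lemma measurable_arrival j (A : set (measurableTypeR R)) :
  (j <= size (val w))%N -> measurable A ->
  measurable (H `&` A_ j @^-1` A : set (measurableTypeR R)).
Proof.
(* Arrival times are monotone on the horizon only. Composing with the projection c onto it gives a
   function monotone on the whole line, hence measurable. *)
move=> jw mA; pose c t : R := Num.max 0 (Num.min t tf).
have cH t : H (c t).
  by rewrite /horizon /= in_itv/= /c le_max lexx ge_max (ltW tf_gt0) ge_min lexx orbT.
have c_homo : {homo c : s t / s <= t}.
  by move=> s t st; rewrite /c ge_max !le_max lexx/= le_min !ge_min st lexx !orbT.
have cE t : H t -> c t = t.
  by rewrite /horizon /= in_itv/= /c => /andP[t0 tt]; rewrite min_l// max_r.
have -> : H `&` A_ j @^-1` A = H `&` (A_ j \o c) @^-1` A.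
  by apply/seteqP; split => t [Ht] /=; rewrite cE.
apply: nondecreasing_measurable => // s t st /=.
by apply: (arrival_homo jw); rewrite ?inE//; exact: c_homo.
Qed.

(** The right side of the defining equation of the load, with a general set in place of [0, t]. *)
Definition inflow (e : edge E) (h : R -> R) (A : set R) : R :=
  \sum_(j < size (val w) | tnth (in_tuple (val w)) j == e)
    \int[mu]_(x in H `&` A_ j @^-1` A) h x.

Lemma inflow_horizon e h A : inflow e h A = inflow e h (H `&` A).
Proof.
apply: eq_bigr => j _; congr Rintegral; apply/seteqP; split => t [Ht At] //=.
  by split => //; split => //; apply: arrival_horizon => //; exact: ltnW.
by split => //; case: At.
Qed.

Lemma inflow_additive e h : L1 h -> set_additive (T := measurableTypeR R) (inflow e h).
Proof.
move=> hi A B mA mB AB; rewrite /inflow -big_split/=; apply: eq_bigr => j _.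
have mI C : measurable (C : set (measurableTypeR R)) ->
    measurable (H `&` A_ j @^-1` C : set (measurableTypeR R)).
  by move=> mC; apply: measurable_arrival => //; exact: ltnW.
rewrite preimage_setU setIUr.
rewrite (@Rint_additive _ _ _ (finite_sigma tf) _ hi _ _ (mI _ mA) (mI _ mB))//.
apply/seteqP; split => // x [[_ Ax] [_ Bx]].
by have : (A `&` B) (A_ j x) by []; rewrite AB.
Qed.

Lemma inflow_norm e h A : L1 h -> measurable (A : set (measurableTypeR R)) ->
  `|inflow e h A| <= inflow e (fun x => `|h x|) A.
Proof.
move=> hi mA; apply: (le_trans (ler_norm_sum _ _ _)); apply: ler_sum => j _.
apply: (@normr_Rint _ _ _ (finite_sigma tf)) => //.
by apply: measurable_arrival => //; exact: ltnW.
Qed.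

Lemma inflow_cont0 e h : L1 h ->
  cont_at_set0 (T := measurableTypeR R) (inflow e (fun x => `|h x|)).
Proof.
move=> hi F mF niF F0.
suff : inflow e (fun x => `|h x|) (F n) @[n --> \oo] -->
    \sum_(j < size (val w) | tnth (in_tuple (val w)) j == e) (0 : R).
  by rewrite big1.
rewrite /inflow; apply: cvg_sumr => j _.
apply: (@Rint_cont0 _ _ _ (finite_sigma tf) _ hi) => [n|m n mn|].
- by apply: measurable_arrival => //; exact: ltnW.
- apply/subsetPset => x [Hx Fx]; split => //.
  by have /subsetPset := niF _ _ mn; apply.
- apply/seteqP; split => // x Fx.
  suff : (\bigcap_n F n) (A_ j x) by rewrite F0.
  by move=> n _; have [] := Fx n I.
Qed.

Lemma inflow_ge0 e h A : L1 h ->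
  (forall B, measurable B -> 0 <= \int[mu]_(x in B) h x) ->
  measurable (A : set (measurableTypeR R)) -> 0 <= inflow e h A.
Proof.
move=> hi h0 mA; apply: sumr_ge0 => j _; apply: h0.
by apply: measurable_arrival => //; exact: ltnW.
Qed.

(* Both sides are additive and dominated, and agree on the intervals [0, t]. *)
Lemma is_load_setwise e (h f : L) : is_load D u w e h f ->
  forall A, measurable (A : set (measurableTypeR R)) ->
    \int[mu]_(x in A) f x = inflow e h A.
Proof.
move=> hf.
have fi := LH_L1 f; have hi := LH_L1 h.
pose m A := \int[mu]_(x in A) `|f x| + inflow e (fun x => `|h x|) A.
(* Only the trace on the horizon matters, and a rational ray leaves there nothing or some [0, t]. *)
have base (A : set (measurableTypeR R)) : measurable A ->
    H `&` A = set0 \/ (exists2 t, H t & H `&` A = [set` `[0, t]]) ->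
    \int[mu]_(x in A) f x = inflow e h A.
  move=> mA HA; rewrite Rint_horizon// inflow_horizon.
  case: HA => [->|[t Ht ->]]; last exact: hf.
  rewrite Rintegral_set0 /inflow big1// => j _.
  by rewrite preimage_set0 setI0 Rintegral_set0.
have baseT : \int[mu]_(x in setT) f x = inflow e h setT.
  apply: base => //; right; exists tf; last by rewrite setIT.
  by rewrite /horizon /= in_itv/= lexx (ltW tf_gt0).
have H1 A : measurable (A : set (measurableTypeR R)) -> 0 <= \int[mu]_(x in A) `|f x|.
  by move=> _; exact: Rintegral_ge0.
have H2 A : measurable (A : set (measurableTypeR R)) -> 0 <= inflow e (fun x => `|h x|) A.
  by move=> _; apply: sumr_ge0 => j _; exact: Rintegral_ge0.
move=> A mA.
(* Uniqueness is read off from [dominated_setwise_cvg] applied to a constant sequence: its limit is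
   also its value. *)
suff cvgA : (fun _ : nat => \int[mu]_(x in A) f x) n @[n --> \oo] --> inflow e h A.
  by apply: (cvg_unique _ _ cvgA) => //; exact: cvg_cst.
apply: (@dominated_setwise_cvg _ (measurableTypeR R) R
  (fun=> fun A => \int[mu]_(x in A) f x) (inflow e h) m _ (rational_rayE R)
  (@rational_rayI R)) mA => [n|||n B mB|B mB||_ [j _ <-]].
- exact: (@Rint_additive _ _ _ (finite_sigma tf)).
- exact: inflow_additive.
- move=> F mF niF F0; rewrite -[0]addr0; apply: cvgD.
    exact: (@Rint_cont0 _ _ _ (finite_sigma tf) _ fi).
  exact: inflow_cont0.
- rewrite /m; have := H2 _ mB; have := @normr_Rint _ _ _ (finite_sigma tf) _ _ fi mB.
  lra.
- rewrite /m; have := H1 _ mB; have := inflow_norm e hi mB; lra.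
- by rewrite baseT; exact: cvg_cst.
- have mr : measurable (@rational_ray R j).
    by rewrite rational_rayE; apply: sub_gen_smallest; exact: imageT.
  rewrite base//; first exact: cvg_cst.
  rewrite /rational_ray; case: (choice.unpickle _) => [q|]; last by left; rewrite setI0.
  have [q0|q0] := ltP (ratr q : R) 0.
    left; apply/seteqP; split => // x [].
    by rewrite /horizon /= in_itv/= => /andP[x0 _] xq; lra.
  right; exists (Num.min (ratr q) tf).
    by rewrite /horizon /= in_itv/= ge_min lexx orbT andbT le_min q0 ltW.
  apply/seteqP; split => x; rewrite /horizon /= !in_itv/= le_min.
    by move=> [/andP[-> ->] ->].
  by move=> /andP[-> /andP[-> ->]].
Qed.

Lemma setwise_is_load e (h f : L) :
  (forall A, measurable (A : set (measurableTypeR R)) ->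
    \int[mu]_(x in A) f x = inflow e h A) -> is_load D u w e h f.
Proof. by move=> hf t _; rewrite hf//; exact: measurable_itv. Qed.

Lemma load_is_load e (h : L) : (exists f, is_load D u w e h f) ->
  is_load D u w e h (load D u w e h).
Proof. by move=> ex; rewrite /load; case: pselect => // ex'; case: cid. Qed.

(** The arrival time at the first edge is the identity, so one summand is the left side and the
    others are nonnegative. The edge does not depend on h, which gives a whole sequence of flows the
    same majorant. *)
Lemma le_inflow_first : exists e, forall h A, L1 h ->
  (forall B, measurable B -> 0 <= \int[mu]_(x in B) h x) ->
  measurable (A : set (measurableTypeR R)) ->
  \int[mu]_(x in A) h x <= inflow e h A.
Proof.
have w0 : (0 < size (val w))%N.
  by have /andP[] := valP w; case: (val w).
exists (tnth (in_tuple (val w)) (Ordinal w0)) => h A hi h0 mA.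
rewrite Rint_horizon// /inflow (bigD1 (Ordinal w0))//=.
rewrite [X in _ <= X + _](_ : _ = \int[mu]_(x in H `&` A) h x); last first.
  by congr Rintegral; rewrite /arrival take0.
rewrite lerDl; apply: sumr_ge0 => j _; apply: h0.
by apply: measurable_arrival => //; exact: ltnW.
Qed.

(** Each position of the walk belongs to exactly one edge and is passed by the whole flow. *)
Lemma sum_inflow (h : R -> R) : L1 h ->
  \sum_(e : edge E) inflow e h setT = (size (val w))%:R * \int[mu]_x h x.
Proof.
move=> hi; rewrite /inflow.
rewrite (exchange_big_dep predT)//= (eq_bigr (fun=> \int[mu]_x h x)).
  by rewrite sumr_const card_ord mulr_natl.
move=> j _; rewrite (eq_bigl (pred1 (tnth (in_tuple (val w)) j))); last first.
  by move=> e; rewrite /= eq_sym.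
by rewrite big_pred1_eq preimage_setT [RHS]Rint_horizon.
Qed.

Lemma inflow_cvg e (h_ : nat -> R -> R) (h : R -> R) A :
  (forall B, measurable (B : set (measurableTypeR R)) ->
    \int[mu]_(x in B) h_ n x @[n --> \oo] --> \int[mu]_(x in B) h x) ->
  measurable (A : set (measurableTypeR R)) ->
  inflow e (h_ n) A @[n --> \oo] --> inflow e h A.
Proof.
move=> hh mA; rewrite /inflow; apply: cvg_sumr => j _; apply: hh.
by apply: measurable_arrival => //; exact: ltnW.
Qed.

End Arrival.
End Load.

(** * Sums and weak convergence in l^1 *)

Section FsetSums.
Context (R : realType) (I : choiceType).
Implicit Types (a : I -> R) (J : {fset I}).

Lemma ler_sum_fset a J J' : (forall i, 0 <= a i) -> (J `<=` J')%fset ->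
  \sum_(i <- J) a i <= \sum_(i <- J') a i.
Proof.
move=> a0 JJ'; rewrite [leRHS](bigID (fun i => i \in J))/=.
have -> : \sum_(i <- J) a i = \sum_(i <- J' | i \in J) a i.
  rewrite -[RHS]big_filter; apply: perm_big.
  apply: uniq_perm; rewrite ?filter_uniq ?fset_uniq// => i.
  rewrite mem_filter; case: (boolP (i \in J)) => //= iJ.
  by move/fsubsetP : JJ' => /(_ _ iJ) ->.
by rewrite lerDl; apply: sumr_ge0.
Qed.

Lemma esum_le_fset a (c : R) : (forall J, \sum_(i <- J) a i <= c) ->
  (\esum_(i in [set: I]) (a i)%:E <= c%:E)%E.
Proof.
move=> ac; apply: ub_ereal_sup => _ [A [Afin _] <-].
by rewrite fsbig_finite//= sumEFin lee_fin.
Qed.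

Lemma fset_le_esum a J : (forall i, 0 <= a i) ->
  ((\sum_(i <- J) a i)%:E <= \esum_(i in [set: I]) (a i)%:E)%E.
Proof.
move=> a0; apply: ereal_sup_ubound; exists [set` J].
  by split => //; exact: finite_fset.
by rewrite fsbig_finite//= ?set_fsetK ?sumEFin//; exact: finite_fset.
Qed.

End FsetSums.

Section FiniteSums.
Context d (T : measurableType d) (R : realType).
Variable mu : {finite_measure set T -> \bar R}.
Local Notation L1 f := (mu.-integrable setT (EFin \o f)).

Lemma L1_sum (I : Type) (r : seq I) (f : I -> T -> R) : (forall i, L1 (f i)) ->
  L1 (fun x => \sum_(i <- r) f i x).
Proof.
move=> fi; elim: r => [|i r ih].
  by under eq_fun do rewrite big_nil; exact: L1_cst.
apply: (@eq_integrable _ _ _ _ _ _ 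
  (EFin \o (fun x => 1 * f i x + \sum_(i <- r) f i x))) => //.
  by move=> x _ /=; rewrite big_cons mul1r.
exact: L1_lin.
Qed.

Lemma Rint_sum (I : Type) (r : seq I) (f : I -> T -> R) A :
  (forall i, L1 (f i)) -> measurable A ->
  \int[mu]_(x in A) (\sum_(i <- r) f i x) = \sum_(i <- r) \int[mu]_(x in A) f i x.
Proof.
move=> fi mA; elim: r => [|i r ih].
  by under eq_Rintegral do rewrite big_nil; rewrite big_nil Rintegral_cst// mul0r.
rewrite big_cons -ih -[X in X + _]mul1r -Rint_lin//; last exact: L1_sum.
by apply: eq_Rintegral => x _; rewrite big_cons mul1r.
Qed.

End FiniteSums.

(** * Unconditional sums of nonnegative families in L(H) *)

Section Lsum.
Context (R : realType) (tf : R) (I : countType).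
Local Notation L := (LH tf).
Local Notation mu := (sigma tf).
Local Notation fmu := (finite_sigma tf).
Implicit Types (f : I -> L) (s g : L).

Let dist (f : I -> L) (J : {fset I}) s :
  ('N[mu]_1[(fun x => (\sum_(i <- J) f i x - s x)%:E)])%E =
  (\int[mu]_x `|-1 * s x + \sum_(i <- J) f i x|)%:E.
Proof.
rewrite hoelder.Lnorm1 (@EFin_Rint _ _ _ fmu)//.
  by apply: eq_integral => x _ /=; rewrite mulN1r addrC.
apply: (@L1_norm _ _ _ fmu); apply: (@L1_lin _ _ _ fmu); first exact: LH_L1.
by apply: (@L1_sum _ _ _ fmu) => i; exact: LH_L1.
Qed.

(** By nonnegativity J may be enlarged to a set whose partial sum is within e of s in norm. *)
Lemma Lsum_setwise_le f s (J : {fset I}) A :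
  (forall i B, measurable (B : set (measurableTypeR R)) -> 0 <= \int[mu]_(x in B) f i x) ->
  Lsum f s -> measurable (A : set (measurableTypeR R)) ->
  \sum_(i <- J) \int[mu]_(x in A) f i x <= \int[mu]_(x in A) s x.
Proof.
move=> f0 fs mA; apply/ler_addgt0Pl => e e0.
have [J0 hJ0] := fs e e0.
have := hJ0 (J0 `|` J)%fset (fsubsetUl _ _).
rewrite dist lte_fin; set K := (J0 `|` J)%fset => hK.
apply: (@le_trans _ _ (\sum_(i <- K) \int[mu]_(x in A) f i x)).
  by apply: ler_sum_fset => [i|]; [exact: f0|exact: fsubsetUr].
have fsi : mu.-integrable setT (EFin \o (fun x => \sum_(i <- K) f i x)).
  by apply: (@L1_sum _ _ _ fmu) => i; exact: LH_L1.
have Di := @L1_lin _ _ _ fmu (-1) _ _ (LH_L1 s) fsi.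
have := @normr_Rint _ _ _ fmu _ _ Di mA.
rewrite (@Rint_lin _ _ _ fmu)//; last exact: LH_L1.
rewrite (@Rint_sum _ _ _ fmu)//; last by move=> i; exact: LH_L1.
have : \int[mu]_(x in A) `|-1 * s x + \sum_(i <- K) f i x| <=
    \int[mu]_x `|-1 * s x + \sum_(i <- K) f i x|.
  have Ni := @L1_norm _ _ _ fmu _ Di.
  rewrite -(@Rint_indicM _ _ _ fmu)//; apply: (@Rint_le _ _ _ fmu) => //.
    apply: (@L1_boundedM _ _ _ fmu) => //; exact: bounded_measurable_indic.
  by move=> x _; rewrite -[leRHS]mul1r ler_wpM2r// indicE lern1; case: (_ \in _).
rewrite ler_norml => h1 /andP[_ h2].
by move: h1 h2 hK; set a := \int[mu]_x _; set b := \int[mu]_(x in A) _;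
  set c := \int[mu]_(x in A) _; set dd := \sum_(i <- _) _; lra.
Qed.

(** Monotone convergence: the sums of the integrals form an additive set function dominated by g,
    and its density is the sum of the family. *)
Lemma Lsum_exists f g :
  (forall i A, measurable (A : set (measurableTypeR R)) -> 0 <= \int[mu]_(x in A) f i x) ->
  (forall (J : {fset I}) A, measurable (A : set (measurableTypeR R)) ->
    \sum_(i <- J) \int[mu]_(x in A) f i x <= \int[mu]_(x in A) g x) ->
  exists2 s, Lsum f s & Lle s g.
Proof.
move=> f0 fg.
pose nuE A := (\esum_(i in [set: I]) (\int[mu]_(x in A) f i x)%:E)%E.
pose nu A := fine (nuE A).
have nuEg A : measurable (A : set (measurableTypeR R)) ->
    (nuE A <= (\int[mu]_(x in A) g x)%:E)%E.
  by move=> mA; apply: esum_le_fset => J; exact: fg.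
have nuE0 A : measurable (A : set (measurableTypeR R)) -> (0 <= nuE A)%E.
  by move=> mA; apply: esum_ge0 => i _; rewrite lee_fin f0.
have nuK A : measurable (A : set (measurableTypeR R)) -> (nu A)%:E = nuE A.
  move=> mA; rewrite fineK// ge0_fin_numE ?nuE0//.
  by rewrite (le_lt_trans (nuEg _ mA))// ltry.
have nu0 A : measurable (A : set (measurableTypeR R)) -> 0 <= nu A.
  by move=> mA; rewrite -lee_fin nuK// nuE0.
have nug A : measurable (A : set (measurableTypeR R)) -> nu A <= \int[mu]_(x in A) g x.
  by move=> mA; rewrite -lee_fin nuK// nuEg.
have nuA : set_additive (T := measurableTypeR R) nu.
  move=> A B mA mB AB; apply/EFin_inj; rewrite EFinD !nuK//; last exact: measurableU.
  rewrite /nuE -esumD; try by move=> i _; rewrite lee_fin f0.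
  by apply: eq_esum => i _; rewrite (@Rint_additive _ _ _ fmu _ (LH_L1 (f i)) _ _ mA mB)// EFinD.
have [s0 s0i nus0] : exists2 s0 : R -> R, mu.-integrable setT (EFin \o s0) &
    forall A, measurable A -> nu A = \int[mu]_(x in A) s0 x.
  apply: (@dominated_density _ _ _ fmu _ _ (LH_L1 g) nuA) => A mA.
  rewrite ger0_norm ?nu0// (le_trans (nug _ mA))//.
  by rewrite (le_trans (ler_norm _))//; apply: (@normr_Rint _ _ _ fmu) => //; exact: LH_L1.
have [s ss0] := LH_of_L1 s0i.
have nus A : measurable (A : set (measurableTypeR R)) -> nu A = \int[mu]_(x in A) s x.
  move=> mA; rewrite nus0//; apply/eqP; rewrite eq_le; apply/andP; split;
  by apply: (@ae_le_Rint _ _ _ fmu) => //; do ?[exact: LH_L1]; apply: filterS ss0 => x ->.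
exists s; last first.
  apply: (@setwise_le_ae _ _ _ fmu); [exact: LH_L1|exact: LH_L1|].
  by move=> A mA; rewrite -nus// nug.
move=> e e0.
(* Since s minus a partial sum is nonnegative, its norm is its integral; hence convergence of the
   total integrals is enough. *)
have [J0 hJ0] : exists J0 : {fset I}, nu setT - e < \sum_(i <- J0) \int[mu]_x f i x.
  apply: contrapT => /forallNP hJ.
  have : (nuE setT <= (nu setT - e)%:E)%E.
    by apply: esum_le_fset => J; rewrite leNgt; apply/negP; exact: hJ.
  by rewrite -nuK// lee_fin; lra.
exists J0 => J J0J; rewrite dist lte_fin.
have fsi : mu.-integrable setT (EFin \o (fun x => \sum_(i <- J) f i x)).
  by apply: (@L1_sum _ _ _ fmu) => i; exact: LH_L1.
have si := LH_L1 s.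
have -> : \int[mu]_x `|-1 * s x + \sum_(i <- J) f i x| =
    \int[mu]_x `|-1 * (\sum_(i <- J) f i x) + s x|.
  by apply: eq_Rintegral => x _; rewrite -normrN; congr `|_|; ring.
rewrite (@setwise_ge0_norm _ _ _ fmu)//; last 2 first.
- exact: (@L1_lin _ _ _ fmu).
- move=> A mA; rewrite (@Rint_lin _ _ _ fmu)// (@Rint_sum _ _ _ fmu)//; last first.
    by move=> i; exact: LH_L1.
  rewrite -nus// addrC mulN1r subr_ge0 -lee_fin nuK//.
  by apply: fset_le_esum => i; exact: f0.
rewrite (@Rint_lin _ _ _ fmu)// (@Rint_sum _ _ _ fmu)//; last by move=> i; exact: LH_L1.
rewrite -nus//.
have : \sum_(i <- J0) \int[mu]_x f i x <= \sum_(i <- J) \int[mu]_x f i x.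
  by apply: ler_sum_fset => // i; exact: f0.
move: hJ0; lra.
Qed.

End Lsum.

(** * Functionals on l^1: single coordinates and tails *)

Section WeakConvergence.
Context (R : realType) (tf : R) (I : countType).
Local Notation L := (LH tf).
Local Notation mu := (sigma tf).
Local Notation fmu := (finite_sigma tf).
Local Notation L1 f := ((sigma tf).-integrable setT (EFin \o f)).

Let toL_ex (f : R -> R) :
  exists F : L, L1 f -> {ae mu, forall x, F x = f x}.
Proof.
have [fi|nfi] := pselect (L1 f).
  by have [F hF] := LH_of_L1 fi; exists F.
have [F _] := LH_of_L1 (@L1_cst _ _ _ fmu 0).
by exists F => /nfi.
Qed.

(** Made total by an arbitrary value on functions that are not integrable, so that a functional on
    L(H) becomes one on functions, as [L1_dual] expects. *)
Definition toL (f : R -> R) : L := sval (cid (toL_ex f)).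

Lemma toLE f : L1 f -> {ae mu, forall x, toL f x = f x}.
Proof. by rewrite /toL; case: cid. Qed.

Definition L0 : L := toL (fun=> 0).

Lemma L0E : {ae mu, forall x, L0 x = 0}.
Proof. by apply: toLE; exact: (@L1_cst _ _ _ fmu). Qed.

Lemma Rint_ae_eq (f g : measurableTypeR R -> R) A : L1 f -> L1 g ->
  measurable (A : set (measurableTypeR R)) ->
  {ae mu, forall x, f x = g x} -> \int[mu]_(x in A) f x = \int[mu]_(x in A) g x.
Proof.
move=> fi gi mA fg; apply/eqP; rewrite eq_le; apply/andP.
by split; apply: (@ae_le_Rint _ _ _ fmu) => //; apply: filterS fg => x ->.
Qed.

Lemma Rint_toL f A : L1 f -> measurable (A : set (measurableTypeR R)) ->
  \int[mu]_(x in A) toL f x = \int[mu]_(x in A) f x.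
Proof. by move=> fi mA; apply: Rint_ae_eq => //; [exact: LH_L1|exact: toLE]. Qed.

Lemma Rnorm_ae_eq (f g : measurableTypeR R -> R) : L1 f -> L1 g ->
  {ae mu, forall x, f x = g x} -> \int[mu]_x `|f x| = \int[mu]_x `|g x|.
Proof.
move=> fi gi fg; apply: Rint_ae_eq => //; do ?exact: (@L1_norm _ _ _ fmu).
by apply: filterS fg => x ->.
Qed.

Lemma Rnorm_L0 : \int[mu]_x `|L0 x| = 0.
Proof.
have := Rnorm_ae_eq (LH_L1 L0) (@L1_cst _ _ _ fmu 0) L0E.
by under [RHS]eq_Rintegral do rewrite normr0; rewrite Rintegral_cst// mul0r.
Qed.

Lemma l1norm_le (h : I -> L) (c : R) :
  (forall J : {fset I}, \sum_(i <- J) \int[mu]_x `|h i x| <= c) ->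
  (l1norm h <= c%:E)%E.
Proof.
move=> hc; rewrite /l1norm; under eq_esum do rewrite Lnorm1E.
exact: esum_le_fset.
Qed.

Lemma l1norm_ge0 (h : I -> L) : (0 <= l1norm h)%E.
Proof. by apply: esum_ge0 => i _; rewrite Lnorm1E lee_fin Rintegral_ge0. Qed.

Lemma l1_le (h : I -> L) (c : R) :
  (forall J : {fset I}, \sum_(i <- J) \int[mu]_x `|h i x| <= c) -> l1 h.
Proof. by move=> /l1norm_le hc; rewrite /l1 /= (le_lt_trans hc)// ltry. Qed.

Lemma bounded_le (phi : (I -> L) -> R) (h : I -> L) (C c : R) :
  (forall f, l1 f -> `|phi f| <= C * fine (l1norm f)) ->
  (forall J : {fset I}, \sum_(i <- J) \int[mu]_x `|h i x| <= c) ->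
  `|phi h| <= `|C| * c.
Proof.
move=> phiC hc; rewrite (le_trans (phiC _ (l1_le hc)))//.
apply: (@le_trans _ _ (`|C| * fine (l1norm h))).
  by rewrite ler_wpM2r ?ler_norm// fine_ge0// l1norm_ge0.
rewrite ler_wpM2l// -lee_fin fineK ?l1norm_le//.
by rewrite ge0_fin_numE ?l1norm_ge0// (le_lt_trans (l1norm_le hc))// ltry.
Qed.

Definition single (i : I) (f : L) : I -> L := fun j => if j == i then f else L0.

Lemma sum_single i f (J : {fset I}) :
  \sum_(j <- J) \int[mu]_x `|single i f j x| <= \int[mu]_x `|f x|.
Proof.
rewrite (eq_bigr (fun j => if j == i then \int[mu]_x `|f x| else 0)); last first.
  by move=> j _; rewrite /single; case: eqP => // _; exact: Rnorm_L0.
rewrite -big_mkcond big_const_seq iter_addr_0.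
rewrite (_ : count _ _ = (i \in J)); last by rewrite -count_uniq_mem// fset_uniq.
by case: (i \in J); rewrite ?mulr1n// mulr0n Rintegral_ge0.
Qed.

Lemma l1_single i f : l1 (single i f).
Proof. exact: l1_le (sum_single i f). Qed.

Definition drop_family (s : seq I) (h : I -> L) : I -> L :=
  fun i => if i \in s then L0 else h i.

Lemma sum_drop_family (J0 J : {fset I}) h :
  \sum_(i <- J) \int[mu]_x `|drop_family J0 h i x| =
  \sum_(i <- (J `\` J0)%fset) \int[mu]_x `|h i x|.
Proof.
rewrite (eq_bigr (fun i => if i \notin J0 then \int[mu]_x `|h i x| else 0)); last first.
  by move=> i _; rewrite /drop_family; case: (i \in _) => //=; exact: Rnorm_L0.
rewrite -big_mkcond -big_filter; apply: perm_big.
apply: uniq_perm; rewrite ?filter_uniq ?fset_uniq// => i.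
by rewrite mem_filter inE.
Qed.

Section Functional.
Variable phi : (I -> L) -> R.
Hypothesis phi_lin : l1_linear phi.
Hypothesis phi_bnd : l1_bounded phi.

Lemma functional_split (h : I -> L) (c : R) (s : seq I) :
  (forall J : {fset I}, \sum_(i <- J) \int[mu]_x `|h i x| <= c) -> uniq s ->
  phi h = \sum_(i <- s) phi (single i (h i)) + phi (drop_family s h).
Proof.
move=> hc; elim: s => [_|i s ih /= /andP[is_ us]].
  by rewrite big_nil add0r; congr phi; apply/funext => i; rewrite /drop_family in_nil.
have ld s' : l1 (drop_family s' h).
  apply: (@l1_le _ c) => J; apply: le_trans (hc J); apply: ler_sum => j _.
  by rewrite /drop_family; case: ifP => // _; rewrite Rnorm_L0 Rintegral_ge0.
rewrite ih// big_cons -addrA addrCA; congr (_ + _).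
rewrite -[phi (single i _)]mul1r; apply: phi_lin => //; first exact: l1_single.
move=> j; apply: filterS L0E => x x0; rewrite /single /drop_family in_cons.
case: eqP => [->|_] /=; last by rewrite x0 mul1r add0r.
by rewrite (negbTE is_) x0 mul1r addr0.
Qed.

Lemma functional_coordinate (i : I) : exists2 b : R -> R,
  bounded_measurable (T := measurableTypeR R) b &
  forall f : L, phi (single i f) = \int[mu]_x (b x * f x).
Proof.
have [C phiC] := phi_bnd.
have [||b bb hb] := @L1_dual _ (measurableTypeR R) R fmu (fun f => phi (single i (toL f))) `|C|.
- move=> a f g fi gi; apply: phi_lin; do ?exact: l1_single.
  have hi := @L1_lin _ _ _ fmu a _ _ fi gi.
  move=> j; rewrite /single; case: eqP => _; last first.
    by apply: filterS L0E => x ->; rewrite mulr0 addr0.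
  apply: filterS3 (toLE hi) (toLE fi) (toLE gi) => x; rewrite -/fmu.
  by move=> -> -> ->.
- move=> f fi; apply: (bounded_le phiC) => J.
  by rewrite (le_trans (sum_single _ _ _))// (Rnorm_ae_eq (LH_L1 _) fi (toLE fi)).
exists b => // f; rewrite -hb; last exact: LH_L1.
(* Invariance of [phi] under almost everywhere equality is its linearity with coefficient 0. *)
rewrite -[RHS]add0r -[X in X + _](mul0r (phi (single i f))).
apply: phi_lin; do ?exact: l1_single.
move=> j; rewrite /single; case: eqP => _; last first.
  by apply: filterS L0E => x ->; rewrite mul0r add0r.
by apply: filterS (toLE (LH_L1 f)) => x ->; rewrite mul0r add0r.
Qed.

End Functional.

(** A functional splits into finitely many coordinates, each an integral against a bounded function
    and hence convergent, and a tail that is small uniformly in n. *)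
Lemma setwise_weak_cvg (h_ : nat -> I -> L) (h : I -> L) (g : I -> L) :
  (forall n i A, measurable (A : set (measurableTypeR R)) ->
    0 <= \int[mu]_(x in A) h_ n i x <= \int[mu]_(x in A) g i x) ->
  (forall i A, measurable (A : set (measurableTypeR R)) ->
    \int[mu]_(x in A) h_ n i x @[n --> \oo] --> \int[mu]_(x in A) h i x) ->
  (forall e, 0 < e -> exists J0 : {fset I}, forall n (J : {fset I}),
    \sum_(i <- (J `\` J0)%fset) \int[mu]_x h_ n i x <= e) ->
  weak_cvg h_ h.
Proof.
move=> h0g_ cvgh tight_.
have h0g i A : measurable (A : set (measurableTypeR R)) ->
    0 <= \int[mu]_(x in A) h i x <= \int[mu]_(x in A) g i x.
  move=> mA; have hA := cvgh i A mA; apply/andP; split.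
    by apply: (cvgr_to_ge hA); apply: nearW => n; have /andP[] := h0g_ n i A mA.
  by apply: (cvgr_to_le hA); apply: nearW => n; have /andP[] := h0g_ n i A mA.
have norm_ n i : \int[mu]_x `|h_ n i x| = \int[mu]_x h_ n i x.
  by rewrite (@setwise_ge0_norm _ _ _ fmu)//; [exact: LH_L1|move=> A /(h0g_ n i)/andP[]].
have norm i : \int[mu]_x `|h i x| = \int[mu]_x h i x.
  by rewrite (@setwise_ge0_norm _ _ _ fmu)//; [exact: LH_L1|move=> A /(h0g i)/andP[]].
(* What the [h_ n] share with their limit: the norm bound by g in each coordinate, and every tail
   bound common to the sequence, with the same [J0]. *)
pose good (k : I -> L) := (forall i, \int[mu]_x `|k i x| <= \int[mu]_x g i x) /\
  forall e, 0 < e -> forall J0 : {fset I},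
    (forall n (J : {fset I}), \sum_(i <- (J `\` J0)%fset) \int[mu]_x h_ n i x <= e) ->
    forall J : {fset I}, \sum_(i <- (J `\` J0)%fset) \int[mu]_x `|k i x| <= e.
have good_ n : good (h_ n).
  split => [i|e e0 J0 hJ0 J]; first by rewrite norm_; have /andP[] := h0g_ n i _ measurableT.
  by rewrite (eq_bigr _ (fun i _ => norm_ n i)).
have goodh : good h.
  split => [i|e e0 J0 hJ0 J]; first by rewrite norm; have /andP[] := h0g i _ measurableT.
  rewrite (eq_bigr _ (fun i _ => norm i)).
  have cvgJ : \sum_(i <- (J `\` J0)%fset) \int[mu]_x h_ n i x @[n --> \oo] -->
      \sum_(i <- (J `\` J0)%fset) \int[mu]_x h i x.
    by apply: cvg_sumr => i _; exact: cvgh.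
  by apply: (cvgr_to_le cvgJ); apply: nearW => n.
have [J1 hJ1] := tight_ 1 ltr01.
(* Bounds the norm of every good family: g controls the coordinates in [J1], and 1 the remaining
   ones. *)
pose c := \sum_(i <- J1) \int[mu]_x g i x + 1.
have good_le k : good k ->
    forall J : {fset I}, \sum_(i <- J) \int[mu]_x `|k i x| <= c.
  move=> [kg kt] J.
  have k0 i : 0 <= \int[mu]_x `|k i x| by exact: Rintegral_ge0.
  rewrite (bigID (fun i => i \in J1))/= lerD//.
    apply: (@le_trans _ _ (\sum_(i <- J1) \int[mu]_x `|k i x|)); last exact: ler_sum.
    rewrite -big_filter (perm_big (enum_fset (J `&` J1)%fset))/=.
      by apply: ler_sum_fset => //; exact: fsubsetIr.
    apply: uniq_perm; rewrite ?filter_uniq ?fset_uniq// => i.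
    by rewrite mem_filter inE andbC.
  rewrite -big_filter (perm_big (enum_fset (J `\` J1)%fset))/=; first exact: kt.
  apply: uniq_perm; rewrite ?filter_uniq ?fset_uniq// => i.
  by rewrite mem_filter inE.
split; first by move=> n; exact: l1_le (good_le _ (good_ n)).
split; first exact: l1_le (good_le _ goodh).
move=> phi phi_lin phi_bnd; apply/cvgrPdist_le => e e0.
have [C phiC] := phi_bnd.
have C1 : 0 < `|C| + 1 by have := normr_ge0 C; lra.
have e' : 0 < e / (3 * (`|C| + 1)) by rewrite divr_gt0// mulr_gt0.
have [J0 hJ0] := tight_ _ e'.
have tail k : good k -> `|phi (drop_family J0 k)| <= e / 3.
  move=> [_ kt]; apply: (@le_trans _ _ (`|C| * (e / (3 * (`|C| + 1))))).
    apply: (bounded_le phiC) => J; rewrite sum_drop_family; exact: kt.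
  rewrite [leLHS](_ : _ = e / 3 * (`|C| / (`|C| + 1))); last by field; rewrite gt_eqF.
  rewrite -[leRHS]mulr1 ler_wpM2l//; first lra.
  by rewrite ler_pdivrMr//; lra.
have cvgJ0 : \sum_(i <- J0) phi (single i (h_ n i)) @[n --> \oo] -->
    \sum_(i <- J0) phi (single i (h i)).
  apply: cvg_sumr => i _.
  have [b bb hb] := functional_coordinate phi_lin phi_bnd i.
  rewrite hb; under eq_fun do rewrite hb.
  apply: (@setwise_cvg_boundedM _ _ _ fmu _ _ (g i)) => //; do ?exact: LH_L1.
  + by move=> n; exact: LH_L1.
  + by move=> n A; exact: h0g_.
  + by move=> A; exact: cvgh.
have e3 : 0 < e / 3 by lra.
move/cvgrPdist_le : cvgJ0 => /(_ _ e3); apply: filterS => n.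
rewrite (functional_split phi_lin (good_le _ goodh) (fset_uniq J0)).
rewrite (functional_split phi_lin (good_le _ (good_ n)) (fset_uniq J0)).
have := tail _ goodh; have := tail _ (good_ n).
rewrite !ler_norml => /andP[? ?] /andP[? ?] /andP[? ?]; apply/andP; split; lra.
Qed.

End WeakConvergence.

(** * The feasible set *)

(** S may be unbounded above, so [a n] is asked to compete, up to 1/(n + 1), only with values cut
    off at n. A finite limit along any [phi] then still bounds S, since the cutoff at n eventually
    exceeds each fixed y. *)
Lemma maximizing_sequence (R : realType) (S : set R) : S !=set0 ->
  exists2 a : nat -> R, forall n, S (a n) &
    forall (phi : nat -> nat) (l : R), (forall n, (n <= phi n)%N) ->
      a (phi n) @[n --> \oo] --> l -> forall y, S y -> y <= l.
Proof.
move=> S0.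
have H n : exists x, S x /\
    forall y, S y -> Num.min y n%:R <= x + n.+1%:R^-1.
  apply: contrapT => /forallNP nH.
  have : 0 < n.+1%:R^-1 :> R by rewrite invr_gt0.
  move: (n.+1%:R^-1) nH => d nH d0.
  (* If no x qualifies, S is bounded by n and yet each of its elements is exceeded in S by more than
     d, against the definition of the supremum. *)
  have climb x : S x -> exists2 y, S y & x + d < y /\ x + d < n%:R.
    move=> Sx; apply: contrapT => hx; apply: (nH x); split => // y Sy.
    by rewrite leNgt lt_min; apply/negP => /andP[h1 h2]; apply: hx; exists y.
  have supS : has_sup S.
    split => //; exists n%:R => x /climb[y _ [_]]; lra.
  have [x Sx hx] := sup_adherent d0 supS.
  have [y Sy [xy _]] := climb _ Sx.
  have : y <= sup S by apply: ub_le_sup => //; case: supS.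
  by move: hx xy; lra.
have [a ha] := choice H.
exists a => [n|phi l phi_ge cvgl y Sy]; first by have [] := ha n.
have cvgl' : a (phi n) + n.+1%:R^-1 @[n --> \oo] --> l + 0.
  apply: cvgD => //.
  apply/cvgrPdist_lt => e e0; near=> n.
  rewrite sub0r normrN ger0_norm ?invr_ge0//.
  by near: n; exact: near_infty_natSinv_lt (PosNum e0).
rewrite -[l]addr0; apply: (cvgr_to_ge cvgl'); near=> n.
have [_ /(_ _ Sy)] := ha (phi n).
have yn : y <= (phi n)%:R.
  apply: (@le_trans _ _ n%:R); last by rewrite ler_nat.
  by near: n; exact: nbhs_infty_ger.
rewrite min_l// => /le_trans; apply; rewrite lerD2l lef_pV2 ?posrE//.
by rewrite ler_nat ltnS.
Unshelve. all: by end_near. Qed.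

Section Feasible.
Context (R : realType) (tf : R) (tf_gt0 : 0 < tf).
Context (V : finType) (E : {set V * V}).
Local Notation L := (LH tf).
Local Notation mu := (sigma tf).
Local Notation fmu := (finite_sigma tf).
Local Notation mset A := (measurable (A : set (measurableTypeR R))).
Context (D : (edge E -> L) -> edge E -> R -> R) (u : edge E -> L).
Hypothesis exit_time_homo : forall e, {in horizon tf &,
  {homo exit_time D u e : s t / s <= t}}.
Hypothesis arrival_horizon : arrivals_in_horizon D u.
Context (I : countType) (W : I -> walk E) (g : edge E -> L).

(** Feasibility in a form stable under setwise limits: integrals over sets, finite partial sums, and
    arbitrary solutions [l] of the load equation instead of the chosen [load]. *)
Definition feasible_loads (h : I -> L) (l : I -> edge E -> L) :=
  [/\ forall i e, is_load D u (W i) e (h i) (l i e),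
      forall i A, mset A -> 0 <= \int[mu]_(x in A) h i x &
      forall e (J : {fset I}) A, mset A ->
        \sum_(i <- J) \int[mu]_(x in A) l i e x <= \int[mu]_(x in A) g e x].

Local Notation load_ h := (fun i e => load D u (W i) e (h i)).

Lemma is_load_ge0 (w : walk E) e (h f : L) : is_load D u w e h f ->
  (forall A, mset A -> 0 <= \int[mu]_(x in A) h x) ->
  forall A, mset A -> 0 <= \int[mu]_(x in A) f x.
Proof.
move=> hf h0 A mA; rewrite (is_load_setwise tf_gt0 exit_time_homo arrival_horizon hf)//.
by apply: inflow_ge0 => //; exact: LH_L1.
Qed.

Lemma feasible_loadsP h : dom D u W h -> nonneg_family h ->
  total_load_le D u W h g -> feasible_loads h (load_ h).
Proof.
move=> [hl _] h0 [s [hs sg]].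
have hi0 i A : mset A -> 0 <= \int[mu]_(x in A) h i x.
  move=> mA; apply: (@le_trans _ _ (\int[mu]_(x in A) (fun=> 0) x)).
    by rewrite Rintegral_cst// mul0r.
  apply: (@ae_le_Rint _ _ _ fmu) => //; [exact: (@L1_cst _ _ _ fmu)|exact: LH_L1|].
  exact: h0.
have hload i e : is_load D u (W i) e (h i) (load D u (W i) e (h i)).
  by apply: load_is_load; exact: hl.
split => // e J A mA.
apply: (@le_trans _ _ (\int[mu]_(x in A) s e x)).
  apply: Lsum_setwise_le (hs e) mA => i B mB.
  exact: is_load_ge0 (hload i e) (hi0 i) B mB.
by apply: (@ae_le_Rint _ _ _ fmu) => //; [exact: LH_L1|exact: LH_L1|exact: sg].
Qed.

Lemma feasible_loads_load h l : feasible_loads h l -> feasible_loads h (load_ h).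
Proof.
move=> [hl h0 lg].
have hload i e : is_load D u (W i) e (h i) (load D u (W i) e (h i)).
  by apply: load_is_load; exists (l i e).
split => // e J A mA; apply: le_trans (lg e J A mA); apply: ler_sum => i _.
by rewrite !(is_load_setwise tf_gt0 exit_time_homo arrival_horizon (hl i e) mA,
             is_load_setwise tf_gt0 exit_time_homo arrival_horizon (hload i e) mA).
Qed.

(** The finite partial sums are bounded by g, so the total load exists and the norms are summable.
    Membership in [dom] is thus derived for a limit, not inherited from the sequence. *)
Lemma feasible_loads_total h l : feasible_loads h l ->
  dom D u W h /\ total_load_le D u W h g.
Proof.
move=> /feasible_loads_load[hl h0 lg].
have l0 i e A : mset A -> 0 <= \int[mu]_(x in A) load D u (W i) e (h i) x.
  by move=> mA; exact: is_load_ge0 (hl i e) (h0 i) A mA.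
split.
  split => [i e|]; first by exists (load D u (W i) e (h i)).
  apply: (@le_lt_trans _ _ (\sum_(e : edge E) \int[mu]_x g e x)%:E); last exact: ltry.
  rewrite (eq_esum (b := fun i => (\sum_(e : edge E)
    \int[mu]_x load D u (W i) e (h i) x)%:E)); last first.
    move=> i _; rewrite -sumEFin; apply: eq_bigr => e _.
    rewrite Lnorm1E (@setwise_ge0_norm _ _ _ fmu)//; first exact: LH_L1.
    by move=> A; exact: l0.
  apply: esum_le_fset => J; rewrite exchange_big/=; apply: ler_sum => e _.
  exact: lg.
have /choice[s hs] : forall e, exists s, Lsum (fun i => load D u (W i) e (h i)) s /\ Lle s (g e).
  move=> e; have [|J A mA|s ? ?] := @Lsum_exists R tf I (fun i => load D u (W i) e (h i)) (g e).
  - by move=> i A; exact: l0.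
  - exact: lg.
  - by exists s.
by exists s; split => e; have [] := hs e.
Qed.

Lemma first_edge : exists e1 : I -> edge E, forall h l, feasible_loads h l ->
  forall i A, mset A -> \int[mu]_(x in A) h i x <= \int[mu]_(x in A) g (e1 i) x.
Proof.
have /choice[e1 he1] := fun i => le_inflow_first tf_gt0 exit_time_homo arrival_horizon (W i).
exists e1 => h l [hl h0 lg] i A mA.
apply: le_trans (he1 i _ _ (LH_L1 (h i)) (h0 i) mA) _.
rewrite -(is_load_setwise tf_gt0 exit_time_homo arrival_horizon (hl i (e1 i)) mA).
by have := lg (e1 i) [fset i]%fset A mA; rewrite big_seq_fset1.
Qed.

Lemma sum_length_le h l (J : {fset I}) : feasible_loads h l ->
  \sum_(i <- J) (size (val (W i)))%:R * \int[mu]_x h i x <=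
  \sum_(e : edge E) \int[mu]_x g e x.
Proof.
move=> [hl h0 lg].
rewrite (eq_bigr (fun i => \sum_(e : edge E) \int[mu]_x l i e x)).
  by rewrite exchange_big/=; apply: ler_sum => e _; exact: lg.
move=> i _; rewrite -(sum_inflow D u (W i))//; last exact: LH_L1.
apply: eq_bigr => e _.
by rewrite (is_load_setwise tf_gt0 exit_time_homo arrival_horizon (hl i e) measurableT).
Qed.

(** A finite graph has finitely many walks of bounded length, and each of them has finitely many
    indices. *)
Lemma finite_short_walks (k : nat) : (forall w, finite_set (W @^-1` [set w])) ->
  finite_set [set i | (size (val (W i)) <= k)%N].
Proof.
move=> Wfin.
have -> : [set i | (size (val (W i)) <= k)%N] =
    \bigcup_(w in [set w : walk E | (size (val w) <= k)%N]) (W @^-1` [set w]).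
  by apply/seteqP; split => [i ik|i [w wk /= ->]//]; exists (W i).
apply: bigcup_finite => // {Wfin}.
have -> : [set w : walk E | (size (val w) <= k)%N] =
    val @^-1` (range (fun s : k.-bseq (edge E) => val s)).
  apply/seteqP; split => w /=; first by move=> wk; exists (Bseq wk).
  by move=> [s _ <-]; exact: size_bseq.
apply: finite_preimage; first by move=> w1 w2 _ _; exact: val_inj.
exact/finite_image/finite_finset.
Qed.

(* Travelling through a long walk loads many edges, so the bound g on the total
   load leaves little flow for the long walks, uniformly in h. *)
Lemma feasible_tight (eps : R) : (forall w, finite_set (W @^-1` [set w])) ->
  0 < eps -> exists J0 : {fset I}, forall h l, feasible_loads h l ->
    forall J : {fset I}, \sum_(i <- (J `\` J0)%fset) \int[mu]_x h i x <= eps.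
Proof.
move=> Wfin e0.
pose c := \sum_(e : edge E) \int[mu]_x g e x.
(* Walks outside [J0] have length at least k + 1, so k + 1 times their flow is at most c, which is
   below k [eps]. *)
pose k := Num.bound `|c / eps|.
have ck : c < k%:R * eps.
  by rewrite -ltr_pdivrMr//; exact: le_lt_trans (ler_norm _) (archi_boundP (normr_ge0 _)).
have Sfin := finite_short_walks k Wfin.
exists (fset_set [set i | (size (val (W i)) <= k)%N]) => h l hl J.
set J' := (J `\` _)%fset.
have k1 : 0 < k.+1%:R :> R by [].
rewrite -(ler_pM2l k1); apply: (@le_trans _ _ c); last first.
  by rewrite -natr1 mulrDl; lra.
apply: le_trans (sum_length_le J' hl).
rewrite mulr_sumr big_seq [leRHS]big_seq; apply: ler_sum => i.
rewrite !inE in_fset_set// => /andP[/negP ik _].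
have [_ h0 _] := hl; rewrite ler_wpM2r ?h0// ler_nat ltnNge.
by apply/negP => ik'; apply: ik; apply/mem_set.
Qed.

(** As u is fixed, inflows are finite sums of integrals of the flow over sets independent of n;
    hence the load equation passes to the limit. *)
Lemma feasible_compact (h_ : nat -> I -> L) :
  (forall w, finite_set (W @^-1` [set w])) ->
  (forall n, exists l, feasible_loads (h_ n) l) ->
  exists2 phi : nat -> nat, forall n, (n <= phi n)%N &
  exists2 h, weak_cvg (fun n => h_ (phi n)) h & exists l, feasible_loads h l.
Proof.
move=> Wfin /choice[l_ hl_].
have [e1 he1] := first_edge.
(* Flows ([None]) and loads ([Some e]) are put into one countable family, so that a single [phi]
   serves them all. *)
pose f (k : I * option (edge E)) n : L :=
  if k.2 is Some e then l_ n k.1 e else h_ n k.1.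
pose G (k : I * option (edge E)) : L := if k.2 is Some e then g e else g (e1 k.1).
have fG k n A : mset A ->
    0 <= \int[mu]_(x in A) f k n x <= \int[mu]_(x in A) G k x.
  move=> mA; have [hl h0 lg] := hl_ n; case: k => i [e|]; rewrite /f /G /=.
    rewrite (is_load_ge0 (hl i e) (h0 i))//=.
    by have := lg e [fset i]%fset A mA; rewrite big_seq_fset1.
  by rewrite h0//=; exact: he1 (hl_ n) i A mA.
have [|||phi phi_ge [F0 F0i cvgF0]] := @dominated_setwise_subsequence _
  (measurableTypeR R) R fmu (I * option (edge E))%type (fun k n => f k n) G _
  (rational_rayE R) (@rational_rayI R).
- by move=> k n; exact: LH_L1.
- by move=> k; exact: LH_L1.
- exact: fG.
pose F k := toL tf (F0 k).
have cvgF k A : mset A ->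
    \int[mu]_(x in A) f k (phi n) x @[n --> \oo] --> \int[mu]_(x in A) F k x.
  by move=> mA; rewrite Rint_toL//; exact: cvgF0.
exists phi => //; exists (fun i => F (i, None)).
  apply: (@setwise_weak_cvg R tf I _ _ (fun i => g (e1 i))).
  - by move=> n i A mA; exact: fG (i, None) (phi n) A mA.
  - by move=> i A mA; exact: cvgF (i, None) A mA.
  - move=> e e0; have [J0 hJ0] := feasible_tight Wfin e0.
    by exists J0 => n J; exact: hJ0 (hl_ (phi n)) J.
exists (fun i e => F (i, Some e)); split.
- move=> i e; apply: setwise_is_load => A mA.
  have cvgl := cvgF (i, Some e) A mA.
  apply: (cvg_unique _ cvgl) => //.
  rewrite (_ : (fun n => _) = (fun n => inflow D u (W i) e (h_ (phi n) i) A)).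
    apply: inflow_cvg => // B mB; exact: cvgF (i, None) B mB.
  apply/funext => n; have [hl _ _] := hl_ (phi n).
  exact: (is_load_setwise tf_gt0 exit_time_homo arrival_horizon (hl i e) mA).
- move=> i A mA; have cvgh := cvgF (i, None) A mA.
  apply: (cvgr_to_ge cvgh); apply: nearW => n.
  by have /andP[] := fG (i, None) (phi n) A mA.
- move=> e J A mA.
  have cvgJ : \sum_(i <- J) \int[mu]_(x in A) f (i, Some e) (phi n) x @[n --> \oo] -->
      \sum_(i <- J) \int[mu]_(x in A) F (i, Some e) x.
    by apply: cvg_sumr => i _; exact: cvgF.
  apply: (cvgr_to_le cvgJ); apply: nearW => n.
  by have [_ _ lg] := hl_ (phi n); exact: lg.
Qed.

End Feasible.

Theorem theorem3p6 (R : realType) (tf : R) (tf_gt0 : 0 < tf)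
  (V : finType) (E : {set V * V})
  (u : edge E -> LH tf)
  (D : (edge E -> LH tf) -> edge E -> R -> R)
  (D_ge0 : forall e, nonneg_on_horizon tf (D u e))
  (D_ac : forall e, abs_continuous_on_horizon tf (D u e))
  (T_nondecreasing : forall e, {in horizon tf &,
     {homo exit_time D u e : s t / s <= t}})
  (u_vanishes : u_vanishes_eventually u)
  (A_in_H : arrivals_in_horizon D u)
  (I : countType) (W : I -> walk E)
  (W_finite_mult : forall w, finite_set (W @^-1` [set w]))
  (g : edge E -> LH tf) (g_ge0 : forall e, Lnonneg (g e))
  (M : set (I -> LH tf))
  (M_sub : M `<=` dom D u W `&` @nonneg_family R tf I)
  (M_feasible : exists2 h, M h & total_load_le D u W h g)
  (theta : (I -> LH tf) -> R)
  (theta_cont : seq_weakly_continuous (@l1_nonneg R tf I) theta)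
  (M_closed : seq_weakly_closed_in (dom D u W) M) :
  exists h, [/\ M h, total_load_le D u W h g &
    forall h', M h' -> total_load_le D u W h' g -> theta h' <= theta h].
Proof.
pose feasible h := M h /\ total_load_le D u W h g.
have feasibleP h : feasible h -> exists l, feasible_loads D u W g h l.
  move=> [/M_sub[dh h0] hg]; exists (fun i e => load D u (W i) e (h i)).
  exact: feasible_loadsP.
have [h0 Mh0 h0g] := M_feasible.
have [|a aS a_max] := @maximizing_sequence R [set theta h | h in feasible].
  by exists (theta h0), h0.
have /choice[h_ hh_] : forall n, exists h, feasible h /\ theta h = a n.
  by move=> n; have [h fh ha] := aS n; exists h.
have [phi phi_ge [h h_cvg [l hl]]] := feasible_compact tf_gt0 T_nondecreasing A_in_H
  W_finite_mult (fun n => feasibleP _ (hh_ n).1).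
have [dom_h hg] := feasible_loads_total tf_gt0 T_nondecreasing A_in_H hl.
(* [M] is closed only relative to [dom], so [dom_h] has to come first. *)
have Mh : M h by apply: M_closed h_cvg => // n; have [[]] := hh_ (phi n).
exists h; split => // h' Mh' h'g.
apply: (a_max phi) => //; last by exists h'.
under eq_fun do rewrite -(hh_ _).2.
have [l1_ [l1h _]] := h_cvg.
apply: theta_cont h_cvg => [n|]; split => //; last by have [] := M_sub _ Mh.
by have [[/M_sub[]]] := hh_ (phi n).
Qed.
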